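(* Let $M\subset\mathbb{C}^n$ be a real hypersurface of class $C^{2,\epsilon}$, $0<\epsilon<1$, and let $\phi$ be an analytic disc of class $C^{1,\delta}$, $0<\delta<\epsilon$, with $\phi(\Gamma)\subset M$. Let $L\subset\mathbb{C}^n$ be a one-dimensional complex linear subspace such that $T^c_{\phi(\sigma)}M\cap L=\{0\}$ for all $\sigma\in\Gamma$, so that $l(\sigma)=T_{\phi(\sigma)}M\cap L$ is a real line through the origin in $L$ for every $\sigma\in\Gamma$. Let $k\in\mathbb{Z}$ be the number of (full) times that the real line $l(\sigma)$ turns in $L$ while $\sigma$ turns once along the unit circle $\Gamma$. Then $$d(\phi)\le\sup(0,\,-2k+1).$$
   Context: $D\subset\mathbb{C}$ is the open unit disc and $\Gamma=\partial D$. $T_pM$ is the real tangent space (a real linear subspace of $\mathbb{C}^n$) and $T^c_pM=T_pM\cap iT_pM$ the complex tangent space. $M$ is assumed to be an open, relatively compact subset of a larger manifold. An analytic disc of class $C^{1,\delta}$ is a map $\phi:\bar D\to\mathbb{C}^n$ of class $C^{1,\delta}$ on $\bar D$ and holomorphic in $D$. Number of turns: identify $L$ with $\mathbb{C}$ by a complex linear isomorphism and choose a continuous $\theta:[0,2\pi]\to\mathbb{R}$ with $l(e^{it})=\mathbb{R}e^{i\theta(t)}$; then $k=(\theta(2\pi)-\theta(0))/2\pi$, which is taken to be an integer. Defect: the holomorphic co-normal bundle $CM$ has as fiber at $p\in M$ the real vector space of forms $\omega=\sum_{j=1}^n a_j\,dz_j$ such that $\operatorname{Im}(\omega)$ vanishes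 on $T_pM$. A section $\sum_j a_j(\sigma)\,dz_j$ of $\phi^*CM\to\Gamma$ extends holomorphically to $D$ if every coefficient $a_j:\Gamma\to\mathbb{C}$ is the boundary value of a function continuous on $\bar D$ and holomorphic in $D$. The defect $d(\phi)$ is the dimension of the real vector space of all $C^{1,\delta}$-sections of $\phi^*CM$ which extend holomorphically to $D$. *)

(* Defs.v *)
From HB Require Import structures.
From mathcomp Require Export all_boot all_order all_algebra.
From mathcomp Require Export all_classical all_reals all_analysis.
From mathcomp Require Export complex.
Export Order.TTheory GRing.Theory Num.Theory numFieldNormedType.Exports.

Set Implicit Arguments.
Unset Strict Implicit.
Unset Printing Implicit Defensive.

Local Open Scope classical_set_scope.
Local Open Scope ring_scope.
Local Open Scope complex_scope.

(* R[i]^o is R[i] seen as a normed module over itself, so that [derivable] at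
   this type is complex differentiability. *)
Notation Cx R := (R[i]^o)%type.
Notation Cn R n := 'rV[R[i]^o]_n.
(* The underlying real normed space R^n x R^n of C^n. *)
Notation Rn2 R n := ('rV[R]_n * 'rV[R]_n)%type.

Definition toR2 (R : realType) (n : nat) (z : Cn R n) : Rn2 R n :=
  (map_mx (@complex.Re R) z, map_mx (@complex.Im R) z).
Definition ofR2 (R : realType) (n : nat) (x : Rn2 R n) : Cn R n :=
  \row_j (x.1 0 j +i* x.2 0 j).

Definition open_disc (R : realType) : set (Cx R) := [set z | `|z| < 1].
Definition closed_disc (R : realType) : set (Cx R) := [set z | `|z| <= 1].
Definition unit_circle (R : realType) : set (Cx R) := [set z | `|z| = 1].
Definition expi (R : realType) (t : R) : Cx R := cos t +i* sin t.

Definition holder_on (R : realType) (V W : normedModType R) (alpha : R)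
    (A : set V) (f : V -> W) : Prop :=
  exists c : R, forall x y : V, A x -> A y -> `|f x - f y| <= c * `|x - y| `^ alpha.

(* Class C^{2,eps} on an open set U: f and its first derivatives are differentiable
   on U (hence continuous), and the second derivatives are Hoelder on U. *)
Definition C2_holder (R : realType) (n : nat) (eps : R) (U : set (Rn2 R n))
    (f : Rn2 R n -> R) : Prop :=
  [/\ forall x, U x -> differentiable f x,
      forall v x, U x -> differentiable ('D_v f) x
    & forall v w, holder_on eps U ('D_w ('D_v f))].

(* f is of class C^{1,delta} on the closed unit disc: continuous there, C^1
   inside, with first derivatives extending to Hoelder functions on the closed disc.
   The domain is identified with R x R to speak of real differentiability. *)
Definition C1_holder_disc (R : realType) (n : nat) (delta : R)
    (f : Cx R -> Cn R n) : Prop :=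
  let z_ (x : R * R) : Cx R := x.1 +i* x.2 in
  let g (x : R * R) : Rn2 R n := toR2 (f (z_ x)) in
  let D := [set x : R * R | open_disc (z_ x)] in
  let Dbar := [set x : R * R | closed_disc (z_ x)] in
  [/\ {within Dbar, continuous g},
      forall x, D x -> differentiable g x
    & forall v : R * R, exists dg : R * R -> Rn2 R n,
        holder_on delta Dbar dg /\ forall x, D x -> 'D_v g x = dg x].

Definition C1_holder_circle (R : realType) (n : nat) (delta : R)
    (a : Cx R -> Cn R n) : Prop :=
  let g (t : R) : Rn2 R n := toR2 (a (expi t)) in
  (forall t : R, derivable g t 1) /\ holder_on delta setT (derive1 g).

Definition analytic_disc (R : realType) (n : nat) (delta : R)
    (phi : Cx R -> Cn R n) : Prop :=
  C1_holder_disc delta phi /\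
  (forall z : Cx R, open_disc z -> derivable phi z 1).

Definition differential (R : realType) (n : nat) (rho : Cn R n -> R)
    (p v : Cn R n) : R :=
  'd (rho \o @ofR2 R n) (toR2 p) (toR2 v).

Definition local_defining (R : realType) (n : nat) (eps : R) (M : set (Cn R n))
    (p : Cn R n) (U : set (Cn R n)) (rho : Cn R n -> R) : Prop :=
  [/\ open U, U p,
      C2_holder eps (@ofR2 R n @^-1` U) (rho \o @ofR2 R n),
      forall q, U q -> exists v, differential rho q v <> 0
    & M `&` U = [set q | rho q = 0] `&` U].

Definition hypersurface (R : realType) (n : nat) (eps : R)
    (M : set (Cn R n)) : Prop :=
  forall p, M p -> exists U rho, local_defining eps M p U rho.

Definition relatively_compact_open_part (R : realType) (n : nat)
    (M M' : set (Cn R n)) : Prop :=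
  [/\ exists2 O : set (Cn R n), open O & M = M' `&` O,
      compact (closure M) & closure M `<=` M'].

(* The kernel of the differential of a local defining function at p; it does not
   depend on the chosen defining function. *)
Definition tangent_space (R : realType) (n : nat) (eps : R) (M : set (Cn R n))
    (p : Cn R n) : set (Cn R n) :=
  [set v | exists U rho, local_defining eps M p U rho /\ differential rho p v = 0].

Definition complex_tangent_space (R : realType) (n : nat) (eps : R)
    (M : set (Cn R n)) (p : Cn R n) : set (Cn R n) :=
  tangent_space eps M p `&`
  [set (0 +i* 1 : R[i]) *: v | v in tangent_space eps M p].

(* A form sum_j a_j dz_j is given by the row a of its coefficients. *)
Definition form_eval (R : realType) (n : nat) (a v : Cn R n) : R[i] :=
  \sum_j a 0 j * v 0 j.

Definition conormal_fiber (R : realType) (n : nat) (eps : R) (M : set (Cn R n))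
    (p : Cn R n) : set (Cn R n) :=
  [set a | forall v, tangent_space eps M p v -> complex.Im (form_eval a v) = 0].

Definition extends_holomorphically (R : realType) (n : nat)
    (a : Cx R -> Cn R n) : Prop :=
  forall j : 'I_n, exists F : Cx R -> Cx R,
    [/\ {within @closed_disc R, continuous F},
        forall z : Cx R, open_disc z -> derivable F z 1
      & forall s, unit_circle s -> F s = a s 0 j].

(* Sections over the unit circle are represented by total functions on R[i] of
   which only the values on the circle matter. *)
Definition extendable_sections (R : realType) (n : nat) (eps delta : R)
    (M : set (Cn R n)) (phi : Cx R -> Cn R n) : set (Cx R -> Cn R n) :=
  [set a | [/\ forall s, unit_circle s -> conormal_fiber eps M (phi s) (a s),
               C1_holder_circle delta a & extends_holomorphically a]].

(* The real vector space of the restrictions to X of the functions in V has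
   (finite) dimension d, i.e. a basis with d elements. *)
Definition has_real_dim_on (R : realType) (n : nat) (X : set (Cx R))
    (V : set (Cx R -> Cn R n)) (d : nat) : Prop :=
  exists e : 'I_d -> Cx R -> Cn R n,
    [/\ forall i, V (e i),
        forall c : 'I_d -> R,
          (forall s, X s -> \sum_i (c i)%:C *: e i s = 0) -> forall i, c i = 0
      & forall a, V a -> exists c : 'I_d -> R,
          forall s, X s -> a s = \sum_i (c i)%:C *: e i s].

Definition has_defect (R : realType) (n : nat) (eps delta : R)
    (M : set (Cn R n)) (phi : Cx R -> Cn R n) (d : nat) : Prop :=
  has_real_dim_on (@unit_circle R) (extendable_sections eps delta M phi) d.

(* v is the image of 1 under a complex linear isomorphism from R[i] onto L, which
   is therefore w |-> w *: v. *)
Definition number_of_turns (R : realType) (n : nat) (L : {vspace Cn R n})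
    (l : Cx R -> set (Cn R n)) (k : int) : Prop :=
  exists (v : Cn R n) (theta : R -> R),
    [/\ v != 0 /\ <[v]>%VS = L,
        {within `[0, pi *+ 2], continuous theta},
        forall t : R, 0 <= t <= pi *+ 2 ->
          l (expi t) = [set (r%:C * expi (theta t)) *: v | r in [set: R]]
      & theta (pi *+ 2) - theta 0 = k%:~R * (pi *+ 2)].

(* Main.v *)
Require Import Defs.
From mathcomp Require Import ring lra zify.

(** Let [v] span [L] and let [theta t] be the angle of the line
    [T_(phi (e^it)) M /\ L] in the coordinate [z |-> z *: v].  A conormal
    section [a] is determined by the scalar function [a v]: the form [a] has a
    real linear imaginary part vanishing on the hyperplane [T M], which does
    not contain [L], so [a] vanishes as soon as [a v] does
    ([conormal_determined]).  If [a] extends holomorphically, [a v] is the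
    boundary value of a function [G] holomorphic in the disc, and since [a] is
    real on [T M], the product [G (e^it) e^(i theta t)] is real.  So the defect
    is at most the real dimension of the space of solutions of this
    Riemann-Hilbert problem, whose angle turns [k] times.

    Write [theta t = k t + tau t] with [tau] periodic.  If [tau] were zero, the
    Fourier coefficients of [G] would satisfy a symmetry that leaves
    [max 0 (1 - 2k)] free real parameters.  In general, approximate [tau]
    uniformly by the real part of a polynomial [P] and multiply [G] by
    [E = e^(iP)].  Then [h = G E] satisfies [h e^(ikt) = r A] with [r] real and
    [A] of argument so close to [0] that [Re (A^2) > 0] ([arg_corrector]).
    Let [m = -k] and suppose that the Fourier coefficients of [h] of index
    below [m] vanish and that the [m]-th is purely imaginary; the negative ones
    vanish anyway, so these are [2m + 1] real linear conditions if [k <= 0] and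
    no condition if [k > 0].  Then [h^2 e^(-2imt)] has the mean value of the
    square of the [m]-th coefficient, a real number [<= 0] ([mean_sqr_le0]),
    while its real part [r^2 Re (A^2)] is nonnegative.  Hence [r = 0] and
    [G = 0] ([riemann_hilbert_uniq]).  Any [max 0 (1 - 2k) + 1] sections are
    therefore linearly dependent, which bounds the defect.

    Two classical facts carry the argument.  The boundary value of a function
    that is continuous on the closed disc and complex differentiable inside has
    no negative Fourier coefficients; this follows from the mean value property
    ([mean_value]), itself a consequence of Goursat's theorem on rectangles in
    the coordinate [log z] ([Goursat]).  A continuous periodic function is the
    uniform limit of its Fejer sums ([fejer_approx]), by Korovkin's argument. *)

Set Implicit Arguments.
Unset Strict Implicit.
Unset Printing Implicit Defensive.

Import ComplexField.Normc.

Local Open Scope classical_set_scope.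
Local Open Scope ring_scope.
Local Open Scope complex_scope.

Local Notation Re := (@complex.Re _).
Local Notation Im := (@complex.Im _).
Local Notation cnorm := ComplexField.Normc.normc.

(** * Complex-valued functions in terms of the real modulus *)

Section ComplexPlane.
Variable R : realType.
Implicit Types (z w : R[i]) (x y : R).

Lemma normE z : `|z| = (cnorm z)%:C.
Proof. by rewrite normc_def; case: z. Qed.

Lemma cnorm_ge0 z : 0 <= cnorm z.
Proof. by case: z => a b /=; rewrite sqrtr_ge0. Qed.

Lemma cnormB z w : cnorm (z - w) = cnorm (w - z).
Proof. by rewrite -normcN opprB. Qed.

Lemma cnorm_real x : cnorm x%:C = `|x|.
Proof. by rewrite /= expr0n addr0 sqrtr_sqr. Qed.

Lemma cnorm_Re z : `|Re z| <= cnorm z.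
Proof.
case: z => a b /=; rewrite -sqrtr_sqr ler_sqrt ?addr_ge0 ?sqr_ge0//.
by rewrite lerDl sqr_ge0.
Qed.

Lemma cnorm_Im z : `|Im z| <= cnorm z.
Proof.
case: z => a b /=; rewrite -sqrtr_sqr ler_sqrt ?addr_ge0 ?sqr_ge0//.
by rewrite lerDr sqr_ge0.
Qed.

Lemma cnorm_leD z : cnorm z <= `|Re z| + `|Im z|.
Proof.
case: z => a b /=; rewrite -(@ger0_norm _ (`|a| + `|b|)) ?addr_ge0//.
rewrite -sqrtr_sqr ler_sqrt ?sqr_ge0// sqrrD !real_normK ?num_real//.
by rewrite addrAC lerDl mulrn_wge0// mulr_ge0.
Qed.

Lemma sqr_cnorm z : cnorm z ^+ 2 = Re z ^+ 2 + Im z ^+ 2.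
Proof. by case: z => a b /=; rewrite sqr_sqrtr// addr_ge0 ?sqr_ge0. Qed.

Lemma ReD z w : Re (z + w) = Re z + Re w. Proof. by case: z w => [? ?] []. Qed.
Lemma ImD z w : Im (z + w) = Im z + Im w. Proof. by case: z w => [? ?] []. Qed.
Lemma ReN z : Re (- z) = - Re z. Proof. by case: z. Qed.
Lemma ImN z : Im (- z) = - Im z. Proof. by case: z. Qed.
Lemma ReB z w : Re (z - w) = Re z - Re w. Proof. by rewrite ReD ReN. Qed.
Lemma ImB z w : Im (z - w) = Im z - Im w. Proof. by rewrite ImD ImN. Qed.
Lemma ReM z w : Re (z * w) = Re z * Re w - Im z * Im w.
Proof. by case: z w => [? ?] []. Qed.
Lemma ImM z w : Im (z * w) = Re z * Im w + Im z * Re w.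
Proof. by case: z w => [? ?] []. Qed.
Lemma ReC x : Re x%:C = x. Proof. by []. Qed.
Lemma ImC x : Im x%:C = 0. Proof. by []. Qed.

Lemma Re_sum (I : Type) (r : seq I) (f : I -> R[i]) :
  Re (\sum_(i <- r) f i) = \sum_(i <- r) Re (f i).
Proof. by elim/big_rec2: _ => // i y1 y2 _ <-; rewrite ReD. Qed.

Lemma Im_sum (I : Type) (r : seq I) (f : I -> R[i]) :
  Im (\sum_(i <- r) f i) = \sum_(i <- r) Im (f i).
Proof. by elim/big_rec2: _ => // i y1 y2 _ <-; rewrite ImD. Qed.

Lemma ReCx x y : Re (x +i* y) = x. Proof. by []. Qed.
Lemma ImCx x y : Im (x +i* y) = y. Proof. by []. Qed.

(** The imaginary unit, kept opaque below so that simplification does not turn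
    products with it into pairs. *)
Definition iC : R[i] := Complex (0 : R) (1 : R).
Lemma Re_iC : Re iC = 0 :> R. Proof. by []. Qed.
Lemma Im_iC : Im iC = 1 :> R. Proof. by []. Qed.
Lemma cnorm_iC : cnorm iC = 1 :> R.
Proof. by rewrite /iC /= expr0n add0r expr1n sqrtr1. Qed.

(** The projections of explicit pairs come first: the rules for sums would also
    apply to them, after unfolding the addition of pairs. *)
Definition ReImE :=
  (ReCx, ImCx, ReC, ImC, Re_iC, Im_iC, ReB, ImB, ReD, ImD, ReN, ImN, ReM, ImM).

Lemma complex_eq z w : Re z = Re w -> Im z = Im w -> z = w.
Proof. by case: z w => [a b] [c d] /= -> ->. Qed.

Lemma posC (e : R[i]) : 0 < e -> exists2 d : R, 0 < d & e = d%:C.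
Proof. by case: e => a b; rewrite ltcE /= => /andP[/eqP -> a0]; exists a. Qed.

Lemma continuous_cnormP (T : topologicalType) (f : T -> Cx R) (x : T) :
  {for x, continuous f} <->
  forall e : R, 0 < e -> \forall y \near x, cnorm (f x - f y) < e.
Proof.
split=> [cf e e0|cf].
  move/cvgrPdist_lt : cf => /(_ e%:C); rewrite ltcR => /(_ e0).
  by apply: filterS => y; rewrite normE ltcR.
apply/cvgrPdist_lt => e /posC[d d0 ->].
by apply: filterS (cf d d0) => y; rewrite normE ltcR.
Qed.

Lemma continuous_Re_comp (T : topologicalType) (f : T -> Cx R) (x : T) :
  {for x, continuous f} -> {for x, continuous (fun t => Re (f t))}.
Proof.
move=> /continuous_cnormP cf; apply/cvgrPdist_lt => e /cf.
by apply: filterS => y; apply: le_lt_trans; rewrite -ReB cnorm_Re.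
Qed.

Lemma continuous_Im_comp (T : topologicalType) (f : T -> Cx R) (x : T) :
  {for x, continuous f} -> {for x, continuous (fun t => Im (f t))}.
Proof.
move=> /continuous_cnormP cf; apply/cvgrPdist_lt => e /cf.
by apply: filterS => y; apply: le_lt_trans; rewrite -ImB cnorm_Im.
Qed.

Lemma continuous_Complex (T : topologicalType) (f g : T -> R) (x : T) :
  {for x, continuous f} -> {for x, continuous g} ->
  {for x, continuous (fun y : T => (f y +i* g y : Cx R))}.
Proof.
move=> cf cg; apply/continuous_cnormP => e e0.
have e20 : 0 < e / 2 by rewrite divr_gt0.
move/cvgrPdist_lt : cf => /(_ _ e20) fe.
move/cvgrPdist_lt : cg => /(_ _ e20) ge.
near=> y.
apply: (le_lt_trans (cnorm_leD _)); rewrite /= [e]splitr ltrD//.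
- by near: y.
- by near: y.
Unshelve. all: by end_near. Qed.

Lemma ccontD (u v : R -> Cx R) : continuous u -> continuous v ->
  continuous (fun t => u t + v t : Cx R).
Proof. by move=> cu cv t; apply: continuousD; [exact: cu|exact: cv]. Qed.

Lemma ccontB (u v : R -> Cx R) : continuous u -> continuous v ->
  continuous (fun t => u t - v t : Cx R).
Proof. by move=> cu cv t; apply: continuousB; [exact: cu|exact: cv]. Qed.

Lemma ccontM (u v : R -> Cx R) : continuous u -> continuous v ->
  continuous (fun t => u t * v t : Cx R).
Proof. by move=> cu cv t; apply: continuousM; [exact: cu|exact: cv]. Qed.

Lemma ccontZ (z : R[i]) (u : R -> Cx R) : continuous u ->
  continuous (fun t => z * u t : Cx R).
Proof. by move=> cu; apply: ccontM => //; exact: cst_continuous. Qed.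

Lemma ccont_sum (J : Type) (r : seq J) (P : pred J) (u : J -> R -> Cx R) :
  (forall j, P j -> continuous (u j)) ->
  continuous (fun t => \sum_(j <- r | P j) u j t : Cx R).
Proof.
move=> cu; elim: r => [|j r IH].
  rewrite (_ : (fun _ => _) = cst 0); first exact: cst_continuous.
  by apply/funext => t; rewrite big_nil.
have [Pj|Pj] := boolP (P j); last first.
  by under eq_fun do rewrite big_cons (negbTE Pj).
under eq_fun do rewrite big_cons Pj; apply: ccontD => //; exact: cu.
Qed.

End ComplexPlane.

(** * Integrals over an interval *)

Section ComplexIntegral.
Variable R : realType.
Implicit Types (a b c : R) (f g : R -> Cx R) (u v : R -> R).
Notation mu := (@lebesgue_measure R).

Definition rint a b u := \int[mu]_(t in `[a, b]) u t.

Lemma continuous_itv_integrable a b u : continuous u ->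
  mu.-integrable `[a, b] (EFin \o u).
Proof.
move=> cu; apply: continuous_compact_integrable; first exact: segment_compact.
exact: continuous_subspaceT.
Qed.
Hint Resolve continuous_itv_integrable : core.

Lemma rintD a b u v : continuous u -> continuous v ->
  rint a b (fun t => u t + v t) = rint a b u + rint a b v.
Proof. by move=> cu cv; apply: RintegralD => //; auto. Qed.

Lemma rintB a b u v : continuous u -> continuous v ->
  rint a b (fun t => u t - v t) = rint a b u - rint a b v.
Proof. by move=> cu cv; apply: RintegralB => //; auto. Qed.

Lemma rintZ a b (k : R) u : continuous u ->
  rint a b (fun t => k * u t) = k * rint a b u.
Proof. by move=> cu; apply: RintegralZl => //; auto. Qed.

Lemma rint_cst a b (k : R) : a <= b -> rint a b (cst k) = k * (b - a).
Proof.
move=> ab; rewrite /rint Rintegral_cst//.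
congr (k * _); transitivity (fine (if (a < b)%R then b%:E - a%:E else 0)%E).
  by congr fine; have := lebesgue_measure_itv `[a, b]; rewrite /= lte_fin => <-.
by case: ltgtP ab => // -> _; rewrite subrr.
Qed.

Lemma eq_rint a b u v : (forall t, a <= t <= b -> u t = v t) ->
  rint a b u = rint a b v.
Proof. by move=> uv; apply: eq_Rintegral => t; rewrite inE/= in_itv/= => /uv. Qed.

Lemma le_rint a b u v : continuous u -> continuous v ->
  (forall t, a <= t <= b -> u t <= v t) -> rint a b u <= rint a b v.
Proof.
by move=> cu cv uv; apply: le_Rintegral; rewrite //=; auto.
Qed.

Lemma rint_cat a b c u : a <= b -> b <= c -> continuous u ->
  rint a c u = rint a b u + rint b c u.
Proof.
move=> ab bc cu.
have := @Rintegral_itvB _ u (BLeft a) (BRight c) b.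
rewrite !bnd_simp => /(_ (continuous_itv_integrable _ _ cu) ab bc).
rewrite Rintegral_itv_obnd_cbnd => [|]; last first.
  apply: integrableS (continuous_itv_integrable b c cu) => //.
  by move=> t; rewrite /= !in_itv/= => /andP[/ltW -> ->].
by rewrite /rint => <-; rewrite addrCA subrr addr0.
Qed.

Lemma rint_FTC a b u U : a <= b -> continuous u ->
  (forall t : R, is_derive t 1 U (u t)) -> rint a b u = U b - U a.
Proof.
move=> + cu dU; rewrite le_eqVlt => /predU1P[->|ab].
  by rewrite /rint subrr set_itv1 Rintegral_set1.
have dU' t : derivable U t 1 by have := dU t => -[].
have cU : continuous U.
  by move=> t; apply: differentiable_continuous; apply/derivable1_diffP.
rewrite /rint /Rintegral (continuous_FTC2 (F := U))//.
- exact: continuous_subspaceT.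
- split; first by [].
  + exact/cvg_at_right_filter/cU.
  + exact/cvg_at_left_filter/cU.
- by move=> t _; rewrite derive1E; have := dU t => -[].
Qed.

#[local] Opaque rint.

Lemma rint_id a b : a <= b -> rint a b id = (b ^+ 2 - a ^+ 2) / 2.
Proof.
move=> ab; pose U (t : R) := t ^+ 2 / 2.
have dU (t : R) : is_derive t 1 U t.
  rewrite /U; apply: is_derive_eq.
  by rewrite /GRing.scale /=; field.
rewrite (@rint_FTC _ _ id U ab _ dU) /U; first by rewrite mulrBl.
by move=> t; exact: cvg_id.
Qed.

(** If [u] were positive at a point, it would stay above half its value on a
    whole interval around it and contribute a positive integral. *)
Lemma rint_eq0 a b u : a < b -> continuous u -> (forall t, a <= t <= b -> 0 <= u t) ->
  rint a b u <= 0 -> forall t, a <= t <= b -> u t = 0.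
Proof.
move=> ab cu u0 iu t tab; apply/eqP; rewrite eq_le u0// andbT leNgt.
apply/negP => ut0.
have /nbhs_ballP[e /= e0 eu] : \forall s \near t, u t / 2 < u s.
  have := cvgr_gt (u t) (cu t); apply.
  by rewrite gtr_pMr// invf_lt1// ltr1n.
have [c [d [cd ac db cde]]] : exists c d, [/\ c < d, a <= c, d <= b &
    forall s, c <= s <= d -> `|t - s| < e].
  have [tb|bt] := ltP t b.
    exists t, (Num.min b (t + e / 2)); split; rewrite ?ge_min ?lexx//.
    - by rewrite lt_min tb/= ltrDl divr_gt0.
    - by case/andP: tab.
    - move=> s; rewrite le_min => /and3P[ts _ se]; rewrite distrC ger0_norm ?subr_ge0//.
      by rewrite ltrBlDl (le_lt_trans se)// ltrD2l gtr_pMr// invf_lt1// ltr1n.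
  have at_ : a < t by exact: lt_le_trans bt.
  exists (Num.max a (t - e / 2)), t; split; rewrite ?le_max ?lexx//.
  - by rewrite gt_max at_/= gtrDl oppr_lt0 divr_gt0.
  - by case/andP: tab.
  - move=> s; rewrite ge_max => /andP[/andP[_ se] st].
    rewrite ger0_norm ?subr_ge0// ltrBlDr -ltrBlDl.
    by rewrite (lt_le_trans _ se)// ltrD2l ltrN2 gtr_pMr// invf_lt1// ltr1n.
have ucd : u t / 2 * (d - c) <= rint c d u.
  rewrite -rint_cst; last exact: ltW.
  apply: le_rint; [exact: cst_continuous|exact: cu|].
  by move=> s /cde se; apply/ltW/eu.
have p0 p q : a <= p -> q <= b -> 0 <= rint p q u.
  move=> ap qb; apply: Rintegral_ge0 => s; rewrite /= in_itv/= => /andP[ps sq].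
  by rewrite u0// (le_trans ap)// (le_trans sq).
move: iu; rewrite (@rint_cat a c b)//; last by rewrite (le_trans _ db)// ltW.
rewrite (rint_cat (ltW cd) db cu) leNgt => /negP; apply.
rewrite ltr_wpDl ?p0//; first by rewrite (le_trans _ db)// ltW.
rewrite ltr_wpDr ?p0//; first by rewrite (le_trans ac)// ltW.
by rewrite (lt_le_trans _ ucd)// mulr_gt0 ?subr_gt0// divr_gt0.
Qed.

Definition cint a b f : R[i] :=
  rint a b (fun t => Re (f t)) +i* rint a b (fun t => Im (f t)).

Let cRe f : continuous f -> continuous (fun t => Re (f t)).
Proof. by move=> cf t; exact/continuous_Re_comp/cf. Qed.

Let cIm f : continuous f -> continuous (fun t => Im (f t)).
Proof. by move=> cf t; exact/continuous_Im_comp/cf. Qed.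
Hint Resolve cRe cIm : core.

Lemma eq_cint a b f g : (forall t, a <= t <= b -> f t = g t) ->
  cint a b f = cint a b g.
Proof.
by move=> fg; congr (_ +i* _); apply: eq_rint => t tab; rewrite fg.
Qed.

Lemma cintD a b f g : continuous f -> continuous g ->
  cint a b (fun t => f t + g t) = cint a b f + cint a b g.
Proof.
move=> cf cg; apply: complex_eq; rewrite !ReImE /= -rintD; auto;
by apply: eq_rint => t _; rewrite ReImE.
Qed.

Lemma cintZ a b (k : R[i]) f : continuous f ->
  cint a b (fun t => k * f t) = k * cint a b f.
Proof.
have cZ r (u : R -> R) : continuous u -> continuous (fun t => r * u t).
  by move=> cu t; apply: cvgMr; exact: cu.
move=> cf; apply: complex_eq; rewrite !ReImE /= -!rintZ/=; auto.
  by rewrite -rintB; auto; apply: eq_rint => t _; rewrite ReImE.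
by rewrite -rintD; auto; apply: eq_rint => t _; rewrite ReImE.
Qed.

Lemma cintB a b f g : continuous f -> continuous g ->
  cint a b (fun t => f t - g t) = cint a b f - cint a b g.
Proof.
move=> cf cg; apply: complex_eq; rewrite !ReImE /= -rintB; auto;
by apply: eq_rint => t _; rewrite ReImE.
Qed.

Lemma cint_cst a b (k : R[i]) : a <= b -> cint a b (cst k) = k * (b - a)%:C.
Proof.
move=> ab; apply: complex_eq; rewrite !ReImE /= mulr0 ?subr0 ?add0r;
by rewrite -rint_cst.
Qed.

Lemma cint_conj a b f : continuous f ->
  cint a b (fun t => (f t)^*) = (cint a b f)^*.
Proof.
move=> cf; apply: complex_eq; rewrite /cint /=.
  by apply: eq_rint => t _; case: (f t).
rewrite -mulN1r -rintZ; last by auto.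
by apply: eq_rint => t _; rewrite mulN1r; case: (f t).
Qed.

Lemma cint_cat a b c f : a <= b -> b <= c -> continuous f ->
  cint a c f = cint a b f + cint b c f.
Proof.
by move=> ab bc cf; apply: complex_eq; rewrite !ReImE /=; apply: rint_cat; auto.
Qed.

Lemma cint_id a b : a <= b ->
  cint a b (fun t => t%:C) = ((b ^+ 2 - a ^+ 2) / 2)%:C.
Proof.
move=> ab; apply: complex_eq => /=; first exact: rint_id.
by rewrite -[RHS](mul0r (b - a)) -rint_cst.
Qed.

(** The factor [2] comes from bounding the real and the imaginary part
    separately; only smallness of such integrals will matter. *)
Lemma cint_le a b f v : continuous f -> continuous v ->
  (forall t, a <= t <= b -> cnorm (f t) <= v t) ->
  cnorm (cint a b f) <= 2 * rint a b v.
Proof.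
move=> cf cv fv; apply: (le_trans (cnorm_leD _)).
have H (u : R -> R) : continuous u -> (forall t, `|u t| <= cnorm (f t)) ->
    `|rint a b u| <= rint a b v.
  move=> cu uf; rewrite ler_norml; apply/andP; split.
    rewrite -[X in - X]mul1r -mulNr -rintZ//; apply: le_rint => //.
      by move=> t; apply: cvgMr; exact: cv.
    move=> t tab; rewrite mulN1r lerNl (le_trans _ (fv t tab))//.
    by rewrite (le_trans _ (uf t))// -normrN ler_norm.
  apply: le_rint => // t tab; rewrite (le_trans _ (fv t tab))//.
  by rewrite (le_trans _ (uf t))// ler_norm.
by rewrite mulr_natl mulr2n lerD// H//=; auto => t; rewrite ?cnorm_Re ?cnorm_Im.
Qed.

Lemma cint_bound a b f (B : R) : a <= b -> continuous f ->
  (forall t, a <= t <= b -> cnorm (f t) <= B) ->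
  cnorm (cint a b f) <= 2 * (B * (b - a)).
Proof.
move=> ab cf fB; rewrite -rint_cst//; apply: cint_le => //.
exact: cst_continuous.
Qed.

End ComplexIntegral.

#[global] Opaque rint cint.
Arguments iC {R}.
#[global] Opaque iC.
#[global] Arguments ComplexField.Normc.normc : simpl never.
#[global] Arguments expi : simpl never.

(** * Goursat's theorem on rectangles *)

Section Goursat.
Variable R : realType.
Local Notation I := (@iC R).

Lemma nested_intervals (x w : R^nat) :
  (forall n, 0 <= w n) -> (forall n, x n <= x n.+1) ->
  (forall n, x n.+1 + w n.+1 <= x n + w n) ->
  exists s, forall n, x n <= s <= x n + w n.
Proof.
move=> w0 xS xwS.
have x_mono m k : x m <= x (m + k)%N.
  by elim: k => [|k IH]; rewrite ?addn0// addnS (le_trans IH).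
have xw_mono m k : x (m + k)%N + w (m + k)%N <= x m + w m.
  by elim: k => [|k IH]; rewrite ?addn0// addnS (le_trans (xwS _)).
have xub m n : x n <= x m + w m.
  have [nm|/ltnW mn] := leqP n m.
    by rewrite -(subnKC nm) (le_trans (x_mono n (m - n)%N))// lerDl.
  by rewrite (le_trans _ (xw_mono m (n - m)%N))// subnKC// lerDl.
exists (sup (range x)) => n; apply/andP; split.
  apply: ub_le_sup; last by exists n.
  by exists (x 0%N + w 0%N) => _ [m _ <-].
apply: ge_sup; first by exists (x 0%N), 0%N.
by move=> _ [m _ <-].
Qed.

(** The integral of [f (ds + i dt)] along the positively oriented boundary of
    the rectangle [[a1, b1] x [a2, b2]]. *)
Definition box_int (f : R -> R -> Cx R) (a1 b1 a2 b2 : R) : R[i] :=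
  cint a1 b1 (f^~ a2) + I * cint a2 b2 (f b1)
  - cint a1 b1 (f^~ b2) - I * cint a2 b2 (f a1).

Implicit Types f : R -> R -> Cx R.

Lemma box_int_split f a1 m1 b1 a2 m2 b2 :
  (forall t, continuous (f^~ t)) -> (forall s, continuous (f s)) ->
  a1 <= m1 -> m1 <= b1 -> a2 <= m2 -> m2 <= b2 ->
  box_int f a1 b1 a2 b2 =
    box_int f a1 m1 a2 m2 + box_int f m1 b1 a2 m2 +
    (box_int f a1 m1 m2 b2 + box_int f m1 b1 m2 b2).
Proof.
move=> cs ct am mb am2 mb2; rewrite /box_int.
rewrite (cint_cat am mb (cs a2)) (cint_cat am mb (cs b2)).
rewrite (cint_cat am2 mb2 (ct b1)) (cint_cat am2 mb2 (ct a1)); ring.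
Qed.

(** An affine function of [s + i t] has a primitive; the integrals over the four
    sides are computed directly. *)
Lemma box_int_affine (k c : R[i]) a1 b1 a2 b2 : a1 <= b1 -> a2 <= b2 ->
  box_int (fun s t => k + c * (s +i* t)) a1 b1 a2 b2 = 0.
Proof.
move=> ab1 ab2.
have cC : continuous (fun t : R => (t%:C : Cx R)).
  by move=> t; apply: continuous_Complex; [exact: cvg_id|exact: cst_continuous].
have cc (z : R[i]) : continuous (fun _ : R => (z : Cx R)) by exact: cst_continuous.
have cM (z : R[i]) : continuous (fun t : R => (z * t%:C : Cx R)).
  by move=> t; apply: continuousM; [exact: cc|exact: cC].
have H (l z : R[i]) a b : a <= b ->
    cint a b (fun t => l + z * t%:C) = l * (b - a)%:C + z * ((b ^+ 2 - a ^+ 2) / 2)%:C.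
  move=> ab; rewrite (cintD a b (cc l) (cM z)) (cint_cst l ab).
  by rewrite (cintZ a b z cC) (cint_id ab).
rewrite /box_int.
have Hs (t a b : R) : a <= b -> cint a b (fun s => k + c * (s +i* t)) =
    (k + c * (I * t%:C)) * (b - a)%:C + c * ((b ^+ 2 - a ^+ 2) / 2)%:C.
  move=> ab; rewrite -H//; apply: eq_cint => s _.
  rewrite -addrA -mulrDr; congr (_ + _ * _).
  by apply: complex_eq; rewrite !ReImE; ring.
have Ht (s a b : R) : a <= b -> cint a b (fun t => k + c * (s +i* t)) =
    (k + c * s%:C) * (b - a)%:C + (c * I) * ((b ^+ 2 - a ^+ 2) / 2)%:C.
  move=> ab; rewrite -H//; apply: eq_cint => t _.
  rewrite -addrA -mulrA -mulrDr; congr (_ + _ * _).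
  by apply: complex_eq; rewrite !ReImE; ring.
rewrite !Hs// !Ht//.
by apply: complex_eq; rewrite !ReImE; field.
Qed.

Lemma box_intB f g a1 b1 a2 b2 :
  (forall t, continuous (f^~ t)) -> (forall s, continuous (f s)) ->
  (forall t, continuous (g^~ t)) -> (forall s, continuous (g s)) ->
  box_int (fun s t => f s t - g s t) a1 b1 a2 b2 =
  box_int f a1 b1 a2 b2 - box_int g a1 b1 a2 b2.
Proof.
move=> fs ft gs gt; rewrite /box_int.
rewrite (cintB _ _ (fs a2) (gs a2)) (cintB _ _ (fs b2) (gs b2)).
rewrite (cintB _ _ (ft a1) (gt a1)) (cintB _ _ (ft b1) (gt b1)); ring.
Qed.

Lemma box_int_bound f a1 b1 a2 b2 (B : R) :
  (forall t, continuous (f^~ t)) -> (forall s, continuous (f s)) ->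
  a1 <= b1 -> a2 <= b2 ->
  (forall s t, a1 <= s <= b1 -> a2 <= t <= b2 -> cnorm (f s t) <= B) ->
  cnorm (box_int f a1 b1 a2 b2) <= 4 * B * ((b1 - a1) + (b2 - a2)).
Proof.
move=> fs ft ab1 ab2 fB; rewrite /box_int.
apply: (le_trans (le_normcD _ _)); rewrite normcN.
apply: (le_trans (lerD (le_normcD _ _) (lexx _))); rewrite normcN.
apply: (le_trans (lerD (lerD (le_normcD _ _) (lexx _)) (lexx _))).
rewrite !normcM cnorm_iC !mul1r.
have s1 : cnorm (cint a1 b1 (f^~ a2)) <= 2 * (B * (b1 - a1)).
  by apply: cint_bound => // s sab; apply: fB; rewrite ?lexx.
have s2 : cnorm (cint a1 b1 (f^~ b2)) <= 2 * (B * (b1 - a1)).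
  by apply: cint_bound => // s sab; apply: fB; rewrite ?lexx ?andbT.
have t1 : cnorm (cint a2 b2 (f a1)) <= 2 * (B * (b2 - a2)).
  by apply: cint_bound => // s sab; apply: fB; rewrite ?lexx.
have t2 : cnorm (cint a2 b2 (f b1)) <= 2 * (B * (b2 - a2)).
  by apply: cint_bound => // s sab; apply: fB; rewrite ?lexx ?andbT.
have -> : 4 * B * (b1 - a1 + (b2 - a2)) = 2 * (B * (b1 - a1)) + 2 * (B * (b2 - a2)) +
  2 * (B * (b1 - a1)) + 2 * (B * (b2 - a2)) by ring.
by rewrite !lerD.
Qed.

(** Complex differentiability at [s0 + i t0] of [f] seen as a function of
    [s + i t]. *)
Definition complex_derivable_at f (s0 t0 : R) := exists c : R[i],
  forall e : R, 0 < e -> exists2 d : R, 0 < d &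
  forall s t, `|s - s0| < d -> `|t - t0| < d ->
    cnorm (f s t - f s0 t0 - c * ((s - s0) +i* (t - t0))) <=
    e * (`|s - s0| + `|t - t0|).

(** Subtracting the affine part of [f] at [(s0, t0)] does not change the integral
    and leaves a function bounded by [e] times the size of the rectangle. *)
Lemma box_int_local f s0 t0 :
  (forall t, continuous (f^~ t)) -> (forall s, continuous (f s)) ->
  complex_derivable_at f s0 t0 ->
  forall e : R, 0 < e -> exists2 d : R, 0 < d &
  forall a1 b1 a2 b2, a1 <= s0 <= b1 -> a2 <= t0 <= b2 ->
    b1 - a1 < d -> b2 - a2 < d ->
    cnorm (box_int f a1 b1 a2 b2) <= 4 * e * ((b1 - a1) + (b2 - a2)) ^+ 2.
Proof.
move=> fs ft [c dfc] e e0; have [d d0 fd] := dfc e e0.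
exists d => // a1 b1 a2 b2; move=> /andP[as0 sb0] /andP[at0 tb0] abd1 abd2.
have ab1 : a1 <= b1 := le_trans as0 sb0.
have ab2 : a2 <= b2 := le_trans at0 tb0.
pose k : R[i] := f s0 t0 - c * (s0 +i* t0).
pose g (s t : R) : Cx R := k + c * (s +i* t).
have gs t : continuous (g^~ t).
  move=> s; apply: continuousD; first exact: cst_continuous.
  apply: continuousM; first exact: cst_continuous.
  by apply: continuous_Complex; [exact: cvg_id|exact: cst_continuous].
have gt s : continuous (g s).
  move=> t; apply: continuousD; first exact: cst_continuous.
  apply: continuousM; first exact: cst_continuous.
  by apply: continuous_Complex; [exact: cst_continuous|exact: cvg_id].
rewrite -[box_int _ _ _ _ _]subr0 -(box_int_affine k c ab1 ab2).
rewrite -(box_intB a1 b1 a2 b2 fs ft gs gt).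
rewrite expr2 mulrA -[4 * e * _]mulrA.
apply: (box_int_bound _ _ ab1 ab2).
- by move=> t; apply: ccontB; [exact: fs|exact: gs].
- by move=> s; apply: ccontB; [exact: ft|exact: gt].
move=> s t /andP[as_ sb] /andP[at_ tb].
have sd : `|s - s0| <= b1 - a1 by rewrite ler_norml; lra.
have td : `|t - t0| <= b2 - a2 by rewrite ler_norml; lra.
have -> : f s t - (k + c * (s +i* t)) =
    f s t - f s0 t0 - c * ((s - s0) +i* (t - t0)).
  by rewrite /k; apply: complex_eq; rewrite !ReImE; ring.
apply: (le_trans (fd _ _ (le_lt_trans sd abd1) (le_lt_trans td abd2))).
by rewrite (ler_pM2l e0); apply: lerD.
Qed.

Let quarter_le (j a b c d : R) : j <= a + b + (c + d) ->
  [\/ j <= 4 * a, j <= 4 * b, j <= 4 * c | j <= 4 * d].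
Proof.
move=> jabcd.
have [?|ja] := leP j (4 * a); first by constructor 1.
have [?|jb] := leP j (4 * b); first by constructor 2.
have [?|jc] := leP j (4 * c); first by constructor 3.
by constructor 4; lra.
Qed.

(** Goursat's bisection: one of the four quarters of a rectangle carries at least
    a quarter of the integral.  Iterating, the integrals over nested rectangles
    decay at most like [4^-n], whereas differentiability at their common point
    makes them [o(4^-n)]. *)
Theorem Goursat f (a1 b1 a2 b2 : R) :
  (forall t, continuous (f^~ t)) -> (forall s, continuous (f s)) ->
  a1 <= b1 -> a2 <= b2 ->
  (forall s t, a1 <= s <= b1 -> a2 <= t <= b2 -> complex_derivable_at f s t) ->
  box_int f a1 b1 a2 b2 = 0.
Proof.
move=> fs ft ab1 ab2 fd.
pose l1 := b1 - a1; pose l2 := b2 - a2; pose h n : R := 2^-1 ^+ n.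
have l10 : 0 <= l1 by rewrite subr_ge0.
have l20 : 0 <= l2 by rewrite subr_ge0.
have h0 n : 0 < h n by rewrite exprn_gt0.
have hS n : h n = h n.+1 + h n.+1 by rewrite /h exprS; field.
pose J n (p : R * R) := box_int f p.1 (p.1 + h n * l1) p.2 (p.2 + h n * l2).
pose next n (p q : R * R) := [/\ p.1 <= q.1, q.1 + h n.+1 * l1 <= p.1 + h n * l1,
  p.2 <= q.2, q.2 + h n.+1 * l2 <= p.2 + h n * l2 & cnorm (J n p) <= 4 * cnorm (J n.+1 q)].
have step (np : nat * (R * R)) : exists q, next np.1 np.2 q.
  case: np => n [x y]; rewrite /next /=.
  set x' := x + h n.+1 * l1; set y' := y + h n.+1 * l2.
  have hl1 : 0 <= h n.+1 * l1 by rewrite mulr_ge0// ltW.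
  have hl2 : 0 <= h n.+1 * l2 by rewrite mulr_ge0// ltW.
  have ex : x + h n * l1 = x' + h n.+1 * l1 by rewrite hS /x'; ring.
  have ey : y + h n * l2 = y' + h n.+1 * l2 by rewrite hS /y'; ring.
  have xx' : x <= x' by rewrite lerDl.
  have yy' : y <= y' by rewrite lerDl.
  have JE : J n (x, y) = J n.+1 (x, y) + J n.+1 (x', y) +
      (J n.+1 (x, y') + J n.+1 (x', y')).
    by rewrite /J /= ex ey; apply: box_int_split => //; rewrite lerDl.
  have : cnorm (J n (x, y)) <= cnorm (J n.+1 (x, y)) + cnorm (J n.+1 (x', y)) +
      (cnorm (J n.+1 (x, y')) + cnorm (J n.+1 (x', y'))).
    by rewrite JE (le_trans (le_normcD _ _))// lerD// le_normcD.
  case/quarter_le => Jq.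
  - by exists (x, y) => /=; rewrite ex ey; split => //; rewrite -addrA lerD2l lerDr.
  - by exists (x', y) => /=; rewrite ex ey; split => //; rewrite -addrA lerD2l lerDr.
  - by exists (x, y') => /=; rewrite ex ey; split => //; rewrite -addrA lerD2l lerDr.
  - by exists (x', y') => /=; rewrite ex ey; split => //; rewrite -addrA lerD2l lerDr.
have [F HF] := choice step.
pose p := fix p n : R * R := if n is n'.+1 then F (n', p n') else (a1, a2).
have pS n : next n (p n) (p n.+1) by exact: (HF (n, p n)).
have [s0 Hs] : exists s, forall n, (p n).1 <= s <= (p n).1 + h n * l1.
  apply: nested_intervals => n; first by rewrite mulr_ge0// ltW.
  - by have [] := pS n.
  - by have [] := pS n.
have [t0 Ht] : exists t, forall n, (p n).2 <= t <= (p n).2 + h n * l2.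
  apply: nested_intervals => n; first by rewrite mulr_ge0// ltW.
  - by have [] := pS n.
  - by have [] := pS n.
have JB n : cnorm (J 0%N (p 0%N)) <= 4 ^+ n * cnorm (J n (p n)).
  elim: n => [|n IH]; first by rewrite expr0 mul1r.
  apply: (le_trans IH); rewrite exprSr -mulrA ler_pM2l ?exprn_gt0//.
  by have [] := pS n.
have J0 : J 0%N (p 0%N) = box_int f a1 b1 a2 b2.
  by rewrite /J /h expr0 !mul1r /l1 /l2 /= !subrKC.
have s0ab : a1 <= s0 <= b1.
  by have := Hs 0%N; rewrite /h expr0 mul1r /l1 /= subrKC.
have t0ab : a2 <= t0 <= b2.
  by have := Ht 0%N; rewrite /h expr0 mul1r /l2 /= subrKC.
apply: eq0_normc; apply/eqP; rewrite eq_le cnorm_ge0 andbT.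
apply/ler_addgt0Pr => e e0; rewrite add0r -J0.
pose A := 4 * (l1 + l2) ^+ 2 + 1.
have A0 : 0 < A by rewrite ltr_wpDl// mulr_ge0// sqr_ge0.
have [d d0 Hd] := box_int_local fs ft (fd _ _ s0ab t0ab) (divr_gt0 e0 A0).
have [n hn] : exists n, h n * (l1 + l2 + 1) < d.
  have : h @ \oo --> (0 : R) by apply: cvg_expr; rewrite gtr0_norm// invf_lt1// ltr1n.
  have D0 : 0 < d / (l1 + l2 + 1) by rewrite divr_gt0// ltr_wpDl// addr_ge0.
  move=> /cvgrPdist_lt/(_ _ D0)[n _ Hn]; exists n.
  have := Hn n (leqnn n); rewrite sub0r normrN gtr0_norm//.
  by rewrite ltr_pdivlMr// ltr_wpDl// addr_ge0.
apply: (le_trans (JB n)).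
have hl i : 0 <= i <= l1 + l2 -> h n * i < d.
  by move=> /andP[i0 il]; apply: le_lt_trans hn; rewrite ler_pM2l//; lra.
have := Hd _ _ _ _ (Hs n) (Ht n).
have addKl (x y : R) : x + y - x = y by rewrite addrAC subrr add0r.
rewrite !addKl => /(_ (hl _ _) (hl _ _)) JH.
have {JH} : cnorm (J n (p n)) <= 4 * (e / A) * (h n * l1 + h n * l2) ^+ 2.
  by apply: JH; rewrite ?l10 ?l20 ?lerDl ?lerDr.
rewrite -(ler_pM2l (exprn_gt0 n (ltr0n R 4 : 0 < 4%:R))) => /le_trans; apply.
have -> : 4 ^+ n * (4 * (e / A) * (h n * l1 + h n * l2) ^+ 2) =
   (4 ^+ n * h n ^+ 2) * (4 * (l1 + l2) ^+ 2) * (e / A) by ring.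
have -> : 4 ^+ n * h n ^+ 2 = 1.
  rewrite /h -exprM mulnC exprM -exprMn.
  by rewrite (_ : 4 * 2^-1 ^+ 2 = 1 :> R) ?expr1n//; field.
rewrite mul1r mulrA ler_pdivrMr// mulrC ler_pM2l// /A lerDl//.
Qed.

End Goursat.

(** * Complex differentiability and the exponential *)

Lemma derivable_approx (K : numFieldType) (f : K^o -> K^o) (x : K^o) :
  derivable f x 1 ->
  forall e : K, 0 < e -> exists2 d : K, 0 < d &
  forall y, `|y - x| < d -> `|f y - f x - 'D_1 f x * (y - x)| <= e * `|y - x|.
Proof.
move=> df e e0.
have dfl : (fun h : K^o => h^-1 *: ((f \o shift x) (h *: (1 : K^o)) - f x))
    @ 0^' --> ('D_1 f x : K^o) by exact: df.
move/cvgrPdist_lt : dfl => /(_ e e0)[d /= d0 dfd]; exists d => // y yd.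
have [->|yx] := eqVneq y x; first by rewrite !subrr mulr0 subrr normr0 mulr0.
have yx0 : y - x != 0 by rewrite subr_eq0.
have := dfd (y - x).
rewrite /ball_ /= sub0r normrN => /(_ yd yx0).
rewrite /GRing.scale /= mulr1 subrK => /ltW H.
rewrite -normrN opprB.
have -> : 'D_1 f x * (y - x) - (f y - f x) =
    ('D_1 f x - (y - x)^-1 * (f y - f x)) * (y - x).
  by rewrite mulrBl mulrAC mulVf// mul1r.
by rewrite normrM ler_pM2r// normr_gt0.
Qed.

Lemma derivable_slope (K : numFieldType) (F : K^o -> K^o) (z : K^o) :
  derivable F z 1 -> exists2 Q : K^o -> K^o, {for z, continuous Q} &
  forall w, F w - F z = Q w * (w - z).
Proof.
move=> dF; exists (fun w : K^o => if w == z then 'D_1 F z else (F w - F z) / (w - z)).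
  apply/(@cvgrPdist_lt _ _ _ _ (nbhs_filter z)) => e e0.
  have e20 : 0 < e / 2 by rewrite divr_gt0.
  have [d d0 Fd] := derivable_approx dF e20.
  exists d => //= w; rewrite /ball_ /= => zw.
  have wd : `|w - z| < d by rewrite distrC.
  rewrite eqxx.
  have [_|wz] := eqVneq w z; first by rewrite subrr normr0.
  have wz0 : w - z != 0 by rewrite subr_eq0.
  have := Fd _ wd.
  have -> : F w - F z - 'D_1 F z * (w - z) =
      ((F w - F z) / (w - z) - 'D_1 F z) * (w - z) by rewrite mulrBl divfK.
  rewrite normrM ler_pM2r ?normr_gt0// distrC => /le_lt_trans; apply.
  by rewrite gtr_pMr// invf_lt1// ltr1n.
move=> w; have [->|wz] := eqVneq w z; first by rewrite !subrr mulr0.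
by rewrite divfK// subr_eq0.
Qed.

Section ComplexDerivative.
Variable R : realType.
Implicit Types (F G Q : Cx R -> Cx R) (z w : Cx R).

(** Complex differentiability in Caratheodory's form: the slope function extends
    continuously to [z].  Products and compositions then reduce to the
    continuity of products and compositions. *)
Definition cdiff F z := exists2 Q : Cx R -> Cx R, {for z, continuous Q} &
  forall w, F w - F z = Q w * (w - z).

Lemma derivable_cdiff F z : derivable F z 1 -> cdiff F z.
Proof. exact: derivable_slope. Qed.

Lemma cdiff_continuous F z : cdiff F z -> {for z, continuous F}.
Proof.
move=> [Q cQ FQ].
have FE : F = (fun w => F z + Q w * (w - z)).
  by apply/funext => w; rewrite -FQ addrC subrK.
rewrite FE; apply: continuousD; first exact: cst_continuous.
apply: continuousM; first exact: cQ.
by apply: continuousB; [exact: cvg_id|exact: cst_continuous].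
Qed.

Lemma cdiff_cst (c : R[i]) z : cdiff (fun=> c) z.
Proof.
exists (fun=> 0); first exact: cst_continuous.
by move=> w; rewrite subrr mul0r.
Qed.

Lemma cdiff_id z : cdiff id z.
Proof.
exists (fun=> 1); first exact: cst_continuous.
by move=> w; rewrite mul1r.
Qed.

Lemma cdiffD F G z : cdiff F z -> cdiff G z -> cdiff (fun w => F w + G w) z.
Proof.
move=> [QF cQF FE] [QG cQG GE]; exists (fun w => QF w + QG w).
  by apply: continuousD; [exact: cQF|exact: cQG].
by move=> w; rewrite mulrDl -FE -GE opprD addrACA.
Qed.

Lemma cdiffM F G z : cdiff F z -> cdiff G z -> cdiff (fun w => F w * G w) z.
Proof.
move=> dF [QG cQG GE]; have cF := cdiff_continuous dF; case: dF => QF cQF FE.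
exists (fun w => F w * QG w + G z * QF w).
  apply: continuousD; first by apply: continuousM; [exact: cF|exact: cQG].
  by apply: continuousM; [exact: cst_continuous|exact: cQF].
by move=> w; rewrite mulrDl -!mulrA -FE -GE; ring.
Qed.

Lemma cdiff_comp F G z : cdiff F z -> cdiff G (F z) -> cdiff (fun w => G (F w)) z.
Proof.
move=> dF [QG cQG GE]; have cF := cdiff_continuous dF; case: dF => QF cQF FE.
exists (fun w => QG (F w) * QF w).
  apply: continuousM; last exact: cQF.
  by apply: continuous_comp; [exact: cF|exact: cQG].
by move=> w; rewrite GE FE mulrA.
Qed.

Lemma cdiff_exp F z n : cdiff F z -> cdiff (fun w => F w ^+ n) z.
Proof.
move=> dF; elim: n => [|n IH]; first by under eq_fun do rewrite expr0; exact: cdiff_cst.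
by under eq_fun do rewrite exprS; exact: cdiffM.
Qed.

Lemma cdiff_sum (J : Type) (r : seq J) (H : J -> Cx R -> Cx R) z :
  (forall j, cdiff (H j) z) -> cdiff (fun w => \sum_(j <- r) H j w) z.
Proof.
move=> dH; elim: r => [|j r IH].
  by under eq_fun do rewrite big_nil; exact: cdiff_cst.
by under eq_fun do rewrite big_cons; exact: cdiffD.
Qed.

Lemma expiD (s t : R) : expi (s + t) = expi s * expi t.
Proof.
by apply: complex_eq; rewrite !ReImE ?sinD ?cosD//; ring.
Qed.

Lemma expi0 : expi 0 = 1 :> Cx R.
Proof. by rewrite /expi cos0 sin0. Qed.

Lemma cnorm_expi (t : R) : cnorm (expi t) = 1.
Proof. by rewrite /normc /expi cos2Dsin2 sqrtr1. Qed.

Lemma continuous_expi : continuous (@expi R).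
Proof.
by move=> t; apply: continuous_Complex; [exact: continuous_cos|exact: continuous_sin].
Qed.

Definition cexp z : Cx R := (expR (Re z))%:C * expi (Im z).

Lemma cexpD z w : cexp (z + w) = cexp z * cexp w.
Proof. by rewrite /cexp !ReImE expRD expiD rmorphM/=; ring. Qed.

Lemma cexp0 : cexp 0 = 1.
Proof. by rewrite /cexp expR0 expi0 mul1r. Qed.

Lemma cnorm_cexp z : cnorm (cexp z) = expR (Re z).
Proof.
by rewrite normcM cnorm_expi mulr1 cnorm_real gtr0_norm// expR_gt0.
Qed.

Lemma is_derive_approx (f : R -> R) (x l : R) : is_derive x 1 f l ->
  forall e, 0 < e -> exists2 d, 0 < d &
  forall y, `|y - x| < d -> `|f y - f x - l * (y - x)| <= e * `|y - x|.
Proof.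
by move=> [df <-] e e0; exact: (@derivable_approx R f x df e e0).
Qed.

(** The error is [e^x (cos y - 1) + (e^x - 1 - x)] plus [i] times
    [e^x (sin y - y) + (e^x - 1) y]; each of the three real expansions is used
    with error [e/9]. *)
Lemma cexp_approx (e : R) : 0 < e -> exists2 d, 0 < d &
  forall z, cnorm z < d -> cnorm (cexp z - 1 - z) <= e * cnorm z.
Proof.
move=> e0; have [e' e'0 [e'1 e'9]] : exists2 e', 0 < e' & e' <= 1 /\ 9 * e' <= e.
  exists (Num.min 1 (e / 9)); first by rewrite lt_min ltr01 divr_gt0.
  by rewrite -ler_pdivlMl// [9^-1 * e]mulrC !ge_min !lexx orbT.
have [d1 d10 H1] := is_derive_approx (is_derive_expR (0 : R)) e'0.
have [d2 d20 H2] := is_derive_approx (is_derive_cos (0 : R)) e'0.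
have [d3 d30 H3] := is_derive_approx (is_derive_sin (0 : R)) e'0.
exists (Num.min (Num.min d1 d2) (Num.min d3 e')).
  by rewrite !lt_min d10 d20 d30 e'0.
case=> x y; rewrite !lt_min => /andP[/andP[zd1 zd2] /andP[zd3 ze']].
set n := cnorm (x +i* y) in zd1 zd2 zd3 ze' *.
have xn : `|x| <= n := cnorm_Re (x +i* y).
have yn : `|y| <= n := cnorm_Im (x +i* y).
have n0 : 0 <= n := cnorm_ge0 _.
have := H1 x; rewrite expR0 subr0 mul1r => /(_ (le_lt_trans xn zd1)) Ex.
have := H2 y; rewrite cos0 sin0 subr0 oppr0 mul0r subr0 => /(_ (le_lt_trans yn zd2)) Cy.
have := H3 y; rewrite cos0 sin0 !subr0 mul1r => /(_ (le_lt_trans yn zd3)) Sy.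
have Ex' : `|expR x - 1 - x| <= e' * n by rewrite (le_trans Ex)// ler_pM2l.
have Cy' : `|cos y - 1| <= e' * n by rewrite (le_trans Cy)// ler_pM2l.
have Sy' : `|sin y - y| <= e' * n by rewrite (le_trans Sy)// ler_pM2l.
have n1 : n <= 1 := le_trans (ltW ze') e'1.
have Ex1 : `|expR x - 1| <= 2 * n.
  rewrite -[expR x - 1](subrK x) (le_trans (ler_normD _ _))//.
  have : e' * n <= n by rewrite ler_piMl.
  lra.
have Ex3 : `|expR x| <= 3.
  rewrite -[expR x](subrK 1) (le_trans (ler_normD _ _))// normr1; lra.
have -> : cexp (x +i* y) - 1 - (x +i* y) =
  (expR x * (cos y - 1) + (expR x - 1 - x)) +i* (expR x * (sin y - y) + (expR x - 1) * y).
  by apply: complex_eq; rewrite /cexp /expi !ReImE /=; ring.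
apply: (le_trans (cnorm_leD _)); rewrite /=.
have A1 : `|expR x * (cos y - 1)| <= 3 * (e' * n) by rewrite normrM ler_pM.
have A2 : `|expR x * (sin y - y)| <= 3 * (e' * n) by rewrite normrM ler_pM.
have A3 : `|(expR x - 1) * y| <= 2 * n * e'.
  by rewrite normrM ler_pM// (le_trans yn)// ltW.
have B1 := ler_normD (expR x * (cos y - 1)) (expR x - 1 - x).
have B2 := ler_normD (expR x * (sin y - y)) ((expR x - 1) * y).
have : 9 * (e' * n) <= e * n by rewrite mulrA ler_wpM2r.
lra.
Qed.

Lemma cdiff_cexp z : cdiff cexp z.
Proof.
pose q (h : Cx R) : Cx R := if h == 0 then 1 else (cexp h - 1) / h.
have cq : {for 0, continuous q}.
  apply/continuous_cnormP => e e0.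
  have [d d0 Hd] := cexp_approx (divr_gt0 e0 (ltr0n R 2)).
  have ci : {for (0 : Cx R), continuous (@id (Cx R))} by exact: cvg_id.
  move/continuous_cnormP : ci => /(_ d d0); apply: filterS => h /=.
  rewrite cnormB subr0 {1}/q eqxx /q => hd.
  have [_|h0] := eqVneq h 0; first by rewrite subrr normc0.
  have h0' : 0 < cnorm h.
    rewrite lt_def cnorm_ge0 andbT; apply: contra h0 => /eqP.
    by move/eq0_normc ->.
  rewrite cnormB -(ltr_pM2r h0') -normcM mulrBl divfK// mul1r.
  apply: (le_lt_trans (Hd _ hd)).
  by rewrite ltr_pM2r// gtr_pMr// invf_lt1// ltr1n.
exists (fun w => cexp z * q (w - z)).
  apply: continuousM; first exact: cst_continuous.
  apply: (@continuous_comp _ _ _ (fun w : Cx R => w - z) q).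
    by apply: continuousB; [exact: cvg_id|exact: cst_continuous].
  by rewrite subrr.
move=> w; have -> : cexp w = cexp z * cexp (w - z) by rewrite -cexpD addrC subrK.
rewrite -mulrA /q subr_eq0.
have [->|wz] := eqVneq w z; first by rewrite subrr cexp0 !mulr0 mulr1 subrr.
by rewrite divfK ?subr_eq0// mulrBr mulr1.
Qed.

(** * The mean value property *)

Lemma closed_discE z : closed_disc z <-> cnorm z <= 1.
Proof. by rewrite /closed_disc /= normE (lecR _ 1). Qed.

Lemma open_discE z : open_disc z <-> cnorm z < 1.
Proof. by rewrite /open_disc /= normE (ltcR _ 1). Qed.

Lemma unit_circle_expi (t : R) : unit_circle (expi t).
Proof. by rewrite /unit_circle /= normE cnorm_expi. Qed.

Lemma closed_disc_expi (t : R) : closed_disc (expi t).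
Proof. by apply/closed_discE; rewrite cnorm_expi. Qed.

Lemma continuous_pair (T U V : topologicalType) (f : T -> U) (g : T -> V) (x : T) :
  {for x, continuous f} -> {for x, continuous g} ->
  {for x, continuous (fun y => (f y, g y))}.
Proof. by move=> cf cg; apply: cvg_pair; [exact: cf|exact: cg]. Qed.

Lemma within_continuous_comp (T S U : topologicalType) (A : set S)
    (g : T -> S) (F : S -> U) (x : T) :
  {within A, continuous F} -> (forall y, A (g y)) -> {for x, continuous g} ->
  {for x, continuous (fun y => F (g y))}.
Proof.
move=> /subspace_continuousP cF Ag cg V /= VF.
have := cF _ (Ag x) V VF; rewrite /= => /cg; rewrite /= !nbhs_simpl /=.
by apply: filterS => y; apply; exact: Ag.
Qed.

Lemma expi_2pi : expi (pi *+ 2) = 1 :> Cx R.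
Proof. by rewrite /expi cos2pi sin2pi. Qed.

(** The disc algebra. *)
Definition holo F :=
  [/\ {within @closed_disc R, continuous F} & forall z, open_disc z -> cdiff F z].

Lemma holo_expi F : holo F -> continuous (fun t => F (expi t)).
Proof.
move=> [cF _] t; apply: (within_continuous_comp cF closed_disc_expi).
exact: continuous_expi.
Qed.

(** In the boundary integral of a rectangle of height [2 pi] the two horizontal
    sides cancel by periodicity, which leaves the two vertical ones. *)
Let side_eq (A B C : R[i]) : A + iC * B - A - iC * C = 0 -> C = B.
Proof.
have -> : A + iC * B - A - iC * C = iC * (B - C) by ring.
move/(congr1 (@normc R)).
rewrite normcM cnorm_iC mul1r normc0.
by move/eq0_normc/eqP; rewrite subr_eq0 => /eqP.
Qed.

(** In the coordinate [s + i t = log z], the circles are the vertical segments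
    of length [2 pi] and [F] is [2 pi]-periodic in [t].  Goursat's theorem shows
    that the integral over such a segment does not depend on [s < 0]; it tends
    to the integral over the unit circle as [s -> 0] and to [2 pi F(0)] as
    [s -> -oo]. *)
Lemma mean_value F : holo F ->
  cint 0 (pi *+ 2) (fun t => F (expi t)) = F 0 * (pi *+ 2)%:C.
Proof.
move=> hF; have [cF dF] := hF.
pose twopi : R := pi *+ 2; have twopi_ge0 : 0 <= twopi by rewrite mulrn_wge0// pi_ge0.
(* Truncating s at 0 makes the composite with F continuous on the whole plane. *)
pose g (s t : R) : Cx R := cexp (Num.min s 0 +i* t).
have gD s t : closed_disc (g s t).
  by apply/closed_discE; rewrite cnorm_cexp/= -expR0 ler_expR ge_min lexx orbT.
have ccexp : continuous cexp by move=> z; apply: cdiff_continuous; exact: cdiff_cexp.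
have cg : continuous (fun p : R * R => g p.1 p.2).
  move=> p; apply: (@continuous_comp _ _ _
    (fun p : R * R => Num.min p.1 0 +i* p.2 : Cx R)); last exact: ccexp.
  apply: continuous_Complex; last exact: cvg_snd.
  by apply: continuous_min; [exact: cvg_fst|exact: cst_continuous].
pose f (s t : R) : Cx R := F (g s t).
have cf : continuous (fun p : R * R => f p.1 p.2).
  move=> p; exact: (@within_continuous_comp _ _ _ _ (fun p : R * R => g p.1 p.2)
    F p cF (fun _ => gD _ _) (cg p)).
have fs t : continuous (f^~ t).
  move=> s; apply: (@continuous_comp _ _ _ (fun s : R => (s, t))
    (fun p : R * R => f p.1 p.2)); last exact: cf.
  by apply: continuous_pair; [exact: cvg_id|exact: cst_continuous].
have ft s : continuous (f s).
  move=> t; apply: (@continuous_comp _ _ _ (fun t : R => (s, t))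
    (fun p : R * R => f p.1 p.2)); last exact: cf.
  by apply: continuous_pair; [exact: cst_continuous|exact: cvg_id].
have f0 t : f 0 t = F (expi t).
  by rewrite /f /g min_l// /cexp !ReImE expR0 mul1r.
have per s : f s twopi = f s 0.
  by rewrite /f /g /cexp !ReImE expi_2pi expi0.
have df s t : s < 0 -> complex_derivable_at f s t.
  move=> s0; have sD : open_disc (g s t).
    by apply/open_discE; rewrite cnorm_cexp/= -expR0 ltr_expR min_l// ltW.
  have [Q cQ FQ] := cdiff_comp (cdiff_cexp (Num.min s 0 +i* t)) (dF _ sD).
  rewrite min_l ?ltW// in cQ FQ.
  exists (Q (s +i* t)) => e e0.
  move/continuous_cnormP : cQ => /(_ e e0) /nbhs_ballP[/= d /posC[d' d'0 ->] Hd].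
  exists (Num.min (- s) (d' / 2)); first by rewrite lt_min oppr_gt0 s0 divr_gt0.
  move=> s' t'; rewrite !lt_min => /andP[ss sd] /andP[_ td].
  have s'0 : s' < 0 by move: ss; rewrite ltr_norml => /andP[]; lra.
  rewrite /f /g (min_l (ltW s'0)) (min_l (ltW s0)) FQ.
  have -> : (s' +i* t') - (s +i* t) = (s' - s) +i* (t' - t) by [].
  rewrite -mulrBl normcM.
  have hn := cnorm_leD ((s' - s) +i* (t' - t)); rewrite /= in hn.
  apply: ler_pM => //; [exact: cnorm_ge0|exact: cnorm_ge0|].
  rewrite cnormB; apply/ltW/Hd; rewrite /ball /= normE ltcR cnormB.
  apply: (le_lt_trans hn); lra.
pose J s := cint 0 twopi (f s).
have JC s1 s2 : s1 <= s2 -> s2 < 0 -> J s1 = J s2.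
  move=> s12 s20.
  have dfs s t : s1 <= s <= s2 -> 0 <= t <= twopi -> complex_derivable_at f s t.
    by move=> /andP[_ ss2] _; apply: df; exact: le_lt_trans s20.
  have := Goursat fs ft s12 twopi_ge0 dfs; rewrite /box_int.
  rewrite (eq_cint (f := f^~ twopi) (g := f^~ 0)) => [|s _]; last exact: per.
  exact: side_eq.
rewrite -/twopi -(eq_cint (f := f 0)); last by move=> t _; exact: f0.
apply/eqP; rewrite -subr_eq0; apply/eqP/eq0_normc/eqP.
rewrite eq_le cnorm_ge0 andbT; apply/ler_addgt0Pr => e e0; rewrite add0r.
pose e' := e / (4 * twopi + 1).
have e'0 : 0 < e' by rewrite divr_gt0// ltr_wpDl// mulr_ge0.
(* The circles of radius e^s with s < 0 close to 0: compactness in t. *)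
have [s2 s20 Hs2] : exists2 s, s < 0 & forall t, 0 <= t <= twopi -> cnorm (f 0 t - f s t) <= e'.
  have /compact_near_coveringP near_cover := @segment_compact R 0 twopi.
  have : \forall s \near 0, forall t, `[0, twopi]%classic t -> cnorm (f 0 t - f s t) < e'.
    apply: (near_cover R (nbhs (0 : R)) (fun s t => cnorm (f 0 t - f s t) < e')) => t _.
    pose h (p : R * R) : Cx R := f 0 p.1 - f p.2 p.1.
    have ch : {for (t, 0), continuous h}.
      apply: continuousB.
        apply: (@continuous_comp _ _ _ (fun p : R * R => p.1) (f 0)); first exact: cvg_fst.
        exact: ft.
      apply: (@continuous_comp _ _ _ (fun p : R * R => (p.2, p.1))
        (fun p : R * R => f p.1 p.2)); last exact: cf.
      by apply: continuous_pair; [exact: cvg_snd|exact: cvg_fst].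
    move/continuous_cnormP : ch => /(_ e' e'0).
    by apply: filterS => -[t' s'] /=; rewrite /h /= subrr sub0r normcN.
  move=> /nbhs_ballP[d /= d0 Hd].
  exists (- (d / 2)); first by rewrite oppr_lt0 divr_gt0.
  move=> t tP; apply/ltW/Hd; last by rewrite /= in_itv.
  by rewrite /ball /= sub0r opprK gtr0_norm ?divr_gt0// gtr_pMr// invf_lt1// ltr1n.
(* The circles of small radius: continuity of F at 0. *)
have [s1 s10 Hs1] : exists2 s, s <= s2 & forall t, cnorm (f s t - F 0) <= e'.
  have D0 : open_disc (0 : Cx R) by apply/open_discE; rewrite normc0.
  have := cdiff_continuous (dF _ D0) => /continuous_cnormP/(_ e' e'0).
  move=> /nbhs_ballP[/= d /posC[d' d'0 ->] Hd].
  exists (Num.min s2 (ln (d' / 2))); first by rewrite ge_min lexx.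
  move=> t; rewrite /f cnormB; apply/ltW/Hd.
  rewrite /ball /= sub0r normrN normE ltcR cnorm_cexp /=.
  rewrite (@le_lt_trans _ _ (d' / 2))//; last by rewrite gtr_pMr// invf_lt1// ltr1n.
  rewrite -[leRHS](@lnK R); last by rewrite posrE divr_gt0.
  by rewrite ler_expR !ge_min lexx orbT.
have c0 : cint 0 twopi (cst (F 0 : Cx R)) = F 0 * twopi%:C by rewrite cint_cst// subr0.
have cF0 : continuous (fun _ : R => F 0) by exact: cst_continuous.
have -> : cint 0 twopi (f 0) - F 0 * twopi%:C =
    (cint 0 twopi (f 0) - J s2) + (J s1 - F 0 * twopi%:C).
  by rewrite (JC _ _ s10 s20) addrA subrK.
rewrite -c0 /J -(cintB 0 twopi (ft 0) (ft s2)) -(cintB 0 twopi (ft s1) cF0).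
apply: (le_trans (le_normcD _ _)).
have K1 := cint_bound twopi_ge0 (ccontB (ft 0) (ft s2)) Hs2.
have K2 := cint_bound twopi_ge0 (ccontB (ft s1) cF0) (fun t _ => Hs1 t).
rewrite subr0 in K1 K2; apply: (le_trans (lerD K1 K2)).
have -> : 2 * (e' * twopi) + 2 * (e' * twopi) = e * ((4 * twopi) / (4 * twopi + 1)).
  by rewrite /e'; ring.
by rewrite ger_pMr// ler_pdivrMr ?mul1r ?lerDl// ltr_wpDl// mulr_ge0.
Qed.

End ComplexDerivative.

(** * Mean values and Fourier coefficients *)

Section Fourier.
Variable R : realType.
Implicit Types (u v : R -> Cx R) (s t : R) (j k m : int).
Local Notation twopi := (pi *+ 2 : R).

Let twopi_gt0 : 0 < twopi. Proof. by rewrite mulrn_wgt0// pi_gt0. Qed.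
Let twopi_ge0 : 0 <= twopi. Proof. exact: ltW. Qed.

Definition mean u : R[i] := (twopi^-1)%:C * cint 0 twopi u.

Lemma eq_mean u v : (forall t, 0 <= t <= twopi -> u t = v t) -> mean u = mean v.
Proof. by move=> uv; rewrite /mean (eq_cint uv). Qed.

Lemma meanD u v : continuous u -> continuous v ->
  mean (fun t => u t + v t) = mean u + mean v.
Proof. by move=> cu cv; rewrite /mean (cintD 0 twopi cu cv) mulrDr. Qed.

Lemma meanB u v : continuous u -> continuous v ->
  mean (fun t => u t - v t) = mean u - mean v.
Proof. by move=> cu cv; rewrite /mean (cintB 0 twopi cu cv) mulrBr. Qed.

Lemma meanZ (c : R[i]) u : continuous u -> mean (fun t => c * u t) = c * mean u.
Proof. by move=> cu; rewrite /mean (cintZ 0 twopi c cu) mulrCA. Qed.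

Lemma mean_cst (c : R[i]) : mean (fun=> c) = c.
Proof.
by rewrite /mean (cint_cst c twopi_ge0) subr0 mulrCA -rmorphM/= mulVf ?mulr1// gt_eqF.
Qed.

Lemma mean_sum (I : Type) (r : seq I) (u : I -> R -> Cx R) :
  (forall i, continuous (u i)) ->
  mean (fun t => \sum_(i <- r) u i t) = \sum_(i <- r) mean (u i).
Proof.
move=> cu; elim: r => [|i r IH].
  rewrite big_nil -[RHS](mean_cst 0); apply: eq_mean => t _.
  by rewrite big_nil.
rewrite big_cons -IH -meanD//; last exact: ccont_sum.
by apply: eq_mean => t _; rewrite big_cons.
Qed.

Lemma mean_le u v : continuous u -> continuous v ->
  (forall t, 0 <= t <= twopi -> cnorm (u t) <= Re (v t)) ->
  cnorm (mean u) <= 2 * Re (mean v).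
Proof.
move=> cu cv uv; have cRv : continuous (fun t => Re (v t)).
  by move=> t; apply: continuous_Re_comp; exact: cv.
have := cint_le cu cRv uv.
rewrite /mean normcM cnorm_real gtr0_norm ?invr_gt0//.
rewrite !ReImE mul0r subr0 (mulrCA 2) ler_pM2l ?invr_gt0//.
Qed.

Lemma Re_mean_le0 u : continuous u ->
  (forall t, 0 <= t <= twopi -> 0 <= Re (u t)) -> Re (mean u) <= 0 ->
  forall t, 0 <= t <= twopi -> Re (u t) = 0.
Proof.
move=> cu u0 mu0; have cRu : continuous (fun t => Re (u t)).
  by move=> t; apply: continuous_Re_comp; exact: cu.
apply: (rint_eq0 twopi_gt0 cRu u0); move: mu0.
by rewrite /mean !ReImE mul0r subr0 pmulr_rle0 ?invr_gt0.
Qed.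

(** The character [e^(ijt)]. *)
Definition em j t : Cx R := expi (j%:~R * t).

Lemma em_continuous j : continuous (em j).
Proof.
move=> t; apply: (@continuous_comp _ _ _ (fun t : R => j%:~R * t) (@expi R)).
  by apply: cvgMr; exact: cvg_id.
exact: continuous_expi.
Qed.

Lemma emD j k t : em (j + k) t = em j t * em k t.
Proof. by rewrite /em rmorphD/= mulrDl expiD. Qed.

Lemma em0 t : em 0 t = 1.
Proof. by rewrite /em mul0r expi0. Qed.

Lemma em_conj j t : em (- j) t = (em j t)^*.
Proof. by rewrite /em rmorphN mulNr /expi /= cosN sinN. Qed.

Lemma cnorm_em j t : cnorm (em j t) = 1.
Proof. exact: cnorm_expi. Qed.

Lemma em_nat (n : nat) t : em n t = expi t ^+ n.
Proof.
elim: n => [|n IH]; first by rewrite em0 expr0.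
by rewrite exprS -IH -[n.+1]addn1 PoszD addrC emD /em mul1r.
Qed.

Lemma em_sub j s t : em j (s - t) = em j s * em (- j) t.
Proof. by rewrite /em mulrBr expiD rmorphN/= mulNr. Qed.

Lemma holoM (F G : Cx R -> Cx R) : holo F -> holo G -> holo (fun z => F z * G z).
Proof.
move=> [cF dF] [cG dG]; split.
  by move=> z; apply: continuousM; [exact: cF|exact: cG].
by move=> z Dz; apply: cdiffM; [exact: dF|exact: dG].
Qed.

Lemma cdiff_holo (F : Cx R -> Cx R) : (forall z, cdiff F z) -> holo F.
Proof.
move=> dF; split => // z.
by apply: continuous_subspaceT => w; exact: cdiff_continuous.
Qed.

(** The mean value property of [z^n F], which vanishes at [0]. *)
Lemma holo_mean_em (F : Cx R -> Cx R) (n : nat) : holo F -> (0 < n)%N ->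
  mean (fun t => F (expi t) * em n t) = 0.
Proof.
move=> hF n0; have hn : holo (fun z : Cx R => z ^+ n).
  by apply: cdiff_holo => z; apply: cdiff_exp; exact: cdiff_id.
rewrite (eq_mean (v := fun t => F (expi t) * (expi t) ^+ n)).
  by rewrite /mean (mean_value (holoM hF hn)) expr0n gtn_eqF//= mulr0 mul0r mulr0.
by move=> t _; rewrite em_nat.
Qed.

Lemma mean_conj u : continuous u -> mean (fun t => (u t)^*) = (mean u)^*.
Proof.
move=> cu; rewrite /mean (cint_conj 0 twopi cu) rmorphM; congr (_ * _).
by apply: complex_eq => //=; rewrite oppr0.
Qed.

Lemma mean_em j : mean (em j) = (j == 0)%:R.
Proof.
have pos (n : nat) : (0 < n)%N -> mean (em n) = 0.
  move=> n0; rewrite -(@holo_mean_em (fun=> 1) n)//.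
    by apply: eq_mean => t _; rewrite mul1r.
  by apply: cdiff_holo => z; exact: cdiff_cst.
case: j => [[|n]|n].
- by rewrite -(mean_cst 1); apply: eq_mean => t _; rewrite em0.
- by rewrite pos.
- rewrite NegzE (eq_mean (v := fun t => (em n.+1 t)^*)) => [|t _].
    by rewrite mean_conj ?pos ?rmorph0//; exact: em_continuous.
  exact: em_conj.
Qed.

Definition fourier u j := mean (fun t => u t * em (- j) t).

Lemma holo_fourier (F : Cx R -> Cx R) j : holo F -> j < 0 ->
  fourier (fun t => F (expi t)) j = 0.
Proof.
move=> hF j0; rewrite /fourier -(holo_mean_em (n := `|j|%N) hF) ?absz_gt0 ?lt_eqF//.
by apply: eq_mean => t _; rewrite -ltz0_abs// opprK.
Qed.

Lemma fourier_em k j : fourier (em k) j = (j == k)%:R.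
Proof.
rewrite /fourier -[j == k]/(j == k) eq_sym -subr_eq0 -mean_em.
by apply: eq_mean => t _; rewrite -emD.
Qed.

End Fourier.
#[global] Opaque mean.

(** * Uniform approximation by Fejer sums *)

Section Fejer.
Variable R : realType.
Implicit Types (u v : R -> Cx R) (s t : R) (j k m : int).
Local Notation twopi := (pi *+ 2 : R).
Local Notation em := (@em R).

(** The form of uniform continuity on the circle that Korovkin's argument needs:
    the oscillation of [u] is controlled, up to [e], by the squared chord, whose
    mean against the Fejer kernel can be computed exactly. *)
Definition chord_modulus u := forall e : R, 0 < e -> exists2 C : R, 0 <= C &
  forall s t, 0 <= s <= twopi -> 0 <= t <= twopi ->
  cnorm (u s - u t) <= e + C * cnorm (expi s - expi t) ^+ 2.

Lemma cos_eq1 (x : R) : 0 <= x <= twopi -> cos x = 1 -> x = 0 \/ x = twopi.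
Proof.
move=> /andP[]; rewrite le_eqVlt => /predU1P[<-|x0]; first by left.
rewrite le_eqVlt => /predU1P[->|xP]; first by right.
have : 0 < sin (x / 2).
  apply: sin_gt0_pi; rewrite divr_gt0//= ltr_pdivrMr//.
  by rewrite mulr_natr.
have -> : cos x = cos (x / 2 + x / 2) by rewrite -splitr.
rewrite cosD => s0 c1.
have := cos2Dsin2 (x / 2); nra.
Qed.

Lemma expi_eq s t : 0 <= s <= twopi -> 0 <= t <= twopi -> expi s = expi t ->
  [\/ s = t, s = 0 /\ t = twopi | s = twopi /\ t = 0].
Proof.
move=> /andP[s0 sP] /andP[t0 tP] st.
have cst_ : cos s = cos t by have := congr1 Re st.
have sst : sin s = sin t by have := congr1 Im st.
have c1 : cos (s - t) = 1 by rewrite cosB cst_ sst -!expr2 cos2Dsin2.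
have [ts|/ltW st'] := leP t s.
  have := @cos_eq1 (s - t); case=> //; first by rewrite subr_ge0 ts /=; lra.
    by move/eqP; rewrite subr_eq0 => /eqP ->; constructor 1.
  by move=> E; constructor 3; lra.
have := @cos_eq1 (t - s); case; first by rewrite subr_ge0 st' /=; lra.
- by rewrite -cosN opprB.
- by move/eqP; rewrite subr_eq0 => /eqP ->; constructor 1.
- by move=> E; constructor 2; lra.
Qed.

(** Near a pair of parameters of distinct points of the circle the chord is
    bounded below and a large [C] suffices; near a pair of parameters of the
    same point [u] oscillates by less than [e].  Compactness of the square of
    [[0, 2 pi]] gives one [C] for all pairs. *)
Lemma continuous_chord_modulus u : continuous u -> u 0 = u twopi -> chord_modulus u.
Proof.
move=> cu u02 e e0.
have cd (v : R -> Cx R) : continuous v ->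
    continuous (fun p : R * R => (v p.1 - v p.2 : Cx R)).
  move=> cv p; apply: continuousB.
    apply: (@continuous_comp _ _ _ (fun p : R * R => p.1) v); first exact: cvg_fst.
    exact: cv.
  apply: (@continuous_comp _ _ _ (fun p : R * R => p.2) v); first exact: cvg_snd.
  exact: cv.
have /compact_near_coveringP near_cover :=
  compact_setX (@segment_compact R 0 twopi) (@segment_compact R 0 twopi).
have : \forall C \near +oo, forall p, (`[0, twopi] `*` `[0, twopi]) p ->
    cnorm (u p.1 - u p.2) <= e + C * cnorm (expi p.1 - expi p.2) ^+ 2.
  apply: (near_cover R (pinfty_nbhs R) (fun C p =>
    cnorm (u p.1 - u p.2) <= e + C * cnorm (expi p.1 - expi p.2) ^+ 2)).
  move=> [s0 t0] [/=]; rewrite !in_itv /= => sI tI.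
  have [est|nest] := eqVneq (expi s0) (expi t0).
    have ust : u s0 = u t0.
      by have [->|[-> ->]|[-> ->]] := expi_eq sI tI est.
    have := (continuous_cnormP _ _).1 (cd _ cu (s0, t0)) e e0; rewrite /= ust subrr => Hd.
    exists ([set p | cnorm (0 - (u p.1 - u p.2)) < e], [set C | 0 < C]) => /=.
      by split => //; exists 0; split.
    move=> [p C] /= []; rewrite sub0r normcN => pe C0.
    by rewrite (le_trans (ltW pe))// lerDl mulr_ge0 ?sqr_ge0// ltW.
  pose c := cnorm (expi s0 - expi t0); pose B := cnorm (u s0 - u t0).
  have c0 : 0 < c.
    rewrite lt_def cnorm_ge0 andbT; apply: contra nest => /eqP.
    by move/eq0_normc/eqP; rewrite subr_eq0.
  have c20 : 0 < c / 2 by rewrite divr_gt0.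
  have B0 : 0 <= B := cnorm_ge0 _.
  have := (continuous_cnormP _ _).1 (cd _ cu (s0, t0)) 1 ltr01; rewrite /= => Hd.
  have := (continuous_cnormP _ _).1 (cd _ (@continuous_expi R) (s0, t0)) (c / 2) c20.
  rewrite /= => He.
  exists ([set p | cnorm (u s0 - u t0 - (u p.1 - u p.2)) < 1] `&`
    [set p | cnorm (expi s0 - expi t0 - (expi p.1 - expi p.2)) < c / 2],
    [set C | (B + 1) / (c / 2) ^+ 2 < C]) => /=.
    split; first exact: filterI.
    by exists ((B + 1) / (c / 2) ^+ 2); split => //; exact: num_real.
  move=> [p C] /= [[pu pe] pC].
  have up : cnorm (u p.1 - u p.2) <= B + 1.
    rewrite -[u p.1 - u p.2](subKr (u s0 - u t0)).
    by apply: (le_trans (le_normcD _ _)); rewrite normcN lerD// ltW.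
  have ep : c / 2 <= cnorm (expi p.1 - expi p.2).
    have := le_normcD (expi s0 - expi t0 - (expi p.1 - expi p.2)) (expi p.1 - expi p.2).
    by rewrite subrK -/c; lra.
  apply: (le_trans up); rewrite ler_wpDl ?(ltW e0)//.
  have C0 : 0 <= C.
    by rewrite (le_trans _ (ltW pC))// divr_ge0 ?addr_ge0// sqr_ge0.
  move: pC; rewrite ltr_pdivrMr ?exprn_gt0// => /ltW/le_trans; apply.
  by rewrite ler_wpM2l// lerXn2r// ?nnegrE ?cnorm_ge0// ltW.
move=> [C0 [_ HC]]; exists (Num.max 0 C0 + 1); first by rewrite addr_ge0// le_max lexx.
move=> s t sI tI; apply: (HC _ _ (s, t)); last by split; rewrite /= in_itv.
by rewrite ltr_pwDr// le_max lexx orbT.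
Qed.

Local Notation D n x := (\sum_(j < n) em j x).

(** The Cesaro mean of the Fourier series of [u], with the factor [1 - |m| / n]
    of the coefficient of index [m] written as [1 / n] times the number of pairs
    [(j, l)] with [j - l = m]. *)
Definition fejer n u t : Cx R := n%:R^-1 *
  \sum_(j < n) \sum_(l < n) em (j%:Z - l%:Z) t * fourier u (j%:Z - l%:Z).

Definition kernel n (x : R) : R := n%:R^-1 * cnorm (D n x) ^+ 2.

Lemma kernel_ge0 n x : 0 <= kernel n x.
Proof. by rewrite mulr_ge0 ?invr_ge0// sqr_ge0. Qed.

Lemma conj_cnorm (z : R[i]) : (cnorm z ^+ 2)%:C = z * z^*.
Proof. by rewrite rmorphXn /= -normE sqr_normc. Qed.

Lemma kernelE n x : (kernel n x)%:C =
  n%:R^-1 * \sum_(j < n) \sum_(l < n) em (j%:Z - l%:Z) x.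
Proof.
rewrite /kernel rmorphM /= fmorphV rmorph_nat conj_cnorm rmorph_sum big_distrlr.
congr (_ * _); apply: eq_bigr => j _; apply: eq_bigr => l _.
by rewrite emD em_conj.
Qed.

Lemma kernel_sub n s t : (kernel n (t - s))%:C =
  n%:R^-1 * \sum_(j < n) \sum_(l < n)
    em (j%:Z - l%:Z) t * em (- (j%:Z - l%:Z)) s.
Proof.
rewrite kernelE; congr (_ * _); apply: eq_bigr => j _; apply: eq_bigr => l _.
exact: em_sub.
Qed.

Lemma continuous_kernel n t : continuous (fun s => (kernel n (t - s))%:C : Cx R).
Proof.
under eq_fun do rewrite kernel_sub.
apply: ccontZ; apply: ccont_sum => j _; apply: ccont_sum => l _.
by apply: ccontZ; exact: em_continuous.
Qed.

(** The nonnegativity of the kernel, invisible in the definition of the sums, is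
    what bounds the error of approximation. *)
Lemma fejerE n u t : continuous u ->
  fejer n u t = mean (fun s => u s * (kernel n (t - s))%:C).
Proof.
move=> cu; pose v (j l : 'I_n) s : Cx R := u s * em (- (j%:Z - l%:Z)) s.
have cv (j l : 'I_n) : continuous (v j l).
  by apply: (ccontM cu); exact: em_continuous.
have cvZ (j l : 'I_n) := @ccontZ R (em (j%:Z - l%:Z) t) _ (cv j l).
have cvS (j : 'I_n) : continuous (fun s => \sum_(l < n) em (j%:Z - l%:Z) t * v j l s).
  by apply: ccont_sum => l _; exact: cvZ.
rewrite (eq_mean (v := fun s => n%:R^-1 *
    (\sum_(j < n) \sum_(l < n) em (j%:Z - l%:Z) t * v j l s))); last first.
  move=> s _; rewrite kernel_sub mulrCA; congr (_ * _).
  rewrite mulr_sumr; apply: eq_bigr => j _; rewrite mulr_sumr.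
  by apply: eq_bigr => l _; rewrite mulrCA.
have cvSS : continuous (fun s =>
    \sum_(j < n) \sum_(l < n) em (j%:Z - l%:Z) t * v j l s : Cx R).
  by apply: ccont_sum => i _; exact: cvS.
rewrite (meanZ _ cvSS) (mean_sum _ cvS).
congr (_ * _); apply: eq_bigr => j _; rewrite (mean_sum _ (cvZ j)).
by apply: eq_bigr => l _; rewrite (meanZ _ (cv j l)).
Qed.

(** The factor [1 - |m| / n], or [0] if [|m| >= n]. *)
Definition diag_weight n m : R :=
  n%:R^-1 * \sum_(j < n) \sum_(l < n) (j%:Z - l%:Z == m)%:R.

Lemma fejer_em n m t : fejer n (em m) t = (diag_weight n m)%:C * em m t.
Proof.
rewrite /fejer /diag_weight rmorphM /= fmorphV rmorph_nat -mulrA; congr (_ * _).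
rewrite rmorph_sum mulr_suml; apply: eq_bigr => j _.
rewrite rmorph_sum mulr_suml; apply: eq_bigr => l _.
rewrite fourier_em rmorph_nat mulrC; have [->//|_] := eqVneq (j%:Z - l%:Z) m.
by rewrite !mul0r.
Qed.

Lemma diag_weight0 n : diag_weight n.+1 0 = 1.
Proof.
rewrite /diag_weight (eq_bigr (fun=> 1)) => [|j _].
  by rewrite big_const_ord iter_addr_0 mulVf// pnatr_eq0.
rewrite (bigD1 j)//= subrr eqxx big1 ?addr0// => l lj.
case: eqP => // /eqP; rewrite subr_eq0 eqz_nat => /eqP jl.
by rewrite -(inj_eq val_inj)/= jl eqxx in lj.
Qed.

Lemma diag_weight1 n : diag_weight n.+1 1 = n%:R / n.+1%:R.
Proof.
rewrite /diag_weight mulrC big_ord_recl big1 ?add0r; last first.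
  by move=> l _; case: eqP => //= /eqP; lia.
congr (_ / _); rewrite (eq_bigr (fun=> 1)) => [|j _].
  by rewrite big_const_ord iter_addr_0.
rewrite (bigD1 (widen_ord (leqnSn n) j))//= /bump /= -addn1 [(1 + j)%N]addnC.
rewrite (_ : _ == 1); last by apply/eqP; lia.
rewrite big1 ?addr0// => l lj.
case: eqP => // /eqP E; move: lj; rewrite -(inj_eq val_inj)/= => /eqP lj.
by exfalso; apply: lj; lia.
Qed.

Lemma diag_weightN n m : diag_weight n (- m) = diag_weight n m.
Proof.
rewrite /diag_weight exchange_big; congr (_ * _).
apply: eq_bigr => j _; apply: eq_bigr => l _.
by rewrite -eqr_oppLR opprB.
Qed.

Lemma mean_kernel n t : mean (fun s => (kernel n.+1 (t - s))%:C) = 1.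
Proof.
transitivity (fejer n.+1 (em 0) t).
  rewrite (fejerE n.+1 t (@em_continuous R 0)).
  by apply: eq_mean => s _; rewrite em0 mul1r.
by rewrite fejer_em diag_weight0 em0 mul1r.
Qed.

Lemma chordE s t : (cnorm (expi s - expi t) ^+ 2)%:C =
  2 - em 1 t * em (-1) s - em (-1) t * em 1 s.
Proof.
rewrite sqr_cnorm /em mul1r rmorphN rmorph1 !mulN1r mul1r.
rewrite /expi !cosN !sinN; have s1 := cos2Dsin2 s; have t1 := cos2Dsin2 t.
have -> : 2 = (2 : R)%:C by rewrite rmorph_nat.
apply: complex_eq; rewrite !ReImE; last by ring.
have -> : 2 = (cos s ^+ 2 + sin s ^+ 2) + (cos t ^+ 2 + sin t ^+ 2) :> R.
  by rewrite s1 t1.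
ring.
Qed.

(** The squared chord is a trigonometric polynomial of degree 1, so its mean
    against the kernel only involves the weights of index [0] and [+-1]. *)
Lemma mean_chord_kernel n t :
  mean (fun s => (cnorm (expi s - expi t) ^+ 2)%:C * (kernel n.+1 (t - s))%:C) =
  (2 / n.+1%:R)%:C.
Proof.
have ck := @continuous_kernel n.+1 t.
have ce j : continuous (fun s => em j s * (kernel n.+1 (t - s))%:C).
  by apply: ccontM ck; exact: em_continuous.
have me j : mean (fun s => em j s * (kernel n.+1 (t - s))%:C) =
    (diag_weight n.+1 j)%:C * em j t.
  by rewrite -(fejerE n.+1 t (@em_continuous R j)) fejer_em.
rewrite (eq_mean (v := fun s => 2 * (kernel n.+1 (t - s))%:C -
  em 1 t * (em (-1) s * (kernel n.+1 (t - s))%:C) -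
  em (-1) t * (em 1 s * (kernel n.+1 (t - s))%:C))); last first.
  by move=> s _; rewrite chordE; ring.
have ck2 := @ccontZ R 2 _ ck.
have ce1 := @ccontZ R (em 1 t) _ (ce (-1)).
have ce2 := @ccontZ R (em (-1) t) _ (ce 1).
rewrite (meanB (ccontB ck2 ce1) ce2) (meanB ck2 ce1).
rewrite (meanZ _ ck) (meanZ _ (ce 1)) (meanZ _ (ce (-1))) mean_kernel !me.
rewrite diag_weightN diag_weight1 mulr1.
rewrite !(mulrCA (em _ t)) -!emD subrr addNr em0 !mulr1.
have -> : 2 = (2 : R)%:C by rewrite rmorph_nat.
rewrite -!rmorphB; congr (_%:C); rewrite -natr1.
have : n%:R + 1 != 0 :> R by rewrite natr1 pnatr_eq0.
by move=> ?; field.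
Qed.

(** Korovkin's argument: integrate the bound [e + C * chord^2] of the oscillation
    of [u] against the Fejer kernel. *)
Theorem fejer_approx u : continuous u -> chord_modulus u ->
  forall e : R, 0 < e -> exists n, forall t, 0 <= t <= twopi ->
  cnorm (fejer n.+1 u t - u t) <= e.
Proof.
move=> cu mu e e0.
have e40 : 0 < e / 4 by rewrite divr_gt0.
have [C C0 HC] := mu _ e40.
have [n Hn] : exists n, C * (2 / n.+1%:R) <= e / 4.
  exists (Num.truncn (C * 2 / (e / 4))).
  rewrite mulrA ler_pdivrMr// -ler_pdivrMl// [leLHS]mulrC.
  exact/ltW/truncnS_gt.
exists n => t tI.
pose k s : R[i] := (kernel n.+1 (t - s))%:C.
have ck : continuous (k : R -> Cx R) by exact: continuous_kernel.
have -> : fejer n.+1 u t - u t = mean (fun s => (u s - u t) * k s).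
  rewrite (fejerE n.+1 t cu) -[u t in LHS]mulr1 -(mean_kernel n t) -(meanZ _ ck).
  rewrite -(meanB (ccontM cu ck) (@ccontZ R (u t) _ ck)).
  by apply: eq_mean => s _; rewrite mulrBl.
pose g s : Cx R := (e / 4)%:C * k s + C%:C * ((cnorm (expi s - expi t) ^+ 2)%:C * k s).
have cc : continuous (fun s => (cnorm (expi s - expi t) ^+ 2)%:C * k s : Cx R).
  apply: ccontM ck; under eq_fun do rewrite chordE.
  apply: ccontB; last by apply: ccontZ; exact: em_continuous.
  apply: ccontB; first exact: cst_continuous.
  by apply: ccontZ; exact: em_continuous.
have cg : continuous g := ccontD (@ccontZ R _ _ ck) (@ccontZ R _ _ cc).
have cu' : continuous (fun s => (u s - u t) * k s : Cx R).
  by apply: ccontM ck; apply: (ccontB cu); exact: cst_continuous.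
apply: (le_trans (mean_le cu' cg _)).
  move=> s sI; rewrite normcM cnorm_real ger0_norm ?kernel_ge0//.
  rewrite /g /k -!rmorphM -rmorphD ReC [C * _]mulrA -mulrDl.
  by rewrite ler_wpM2r ?kernel_ge0 ?HC.
have -> : mean g = (e / 4)%:C + C%:C * (2 / n.+1%:R)%:C.
  rewrite (meanD (@ccontZ R _ _ ck) (@ccontZ R _ _ cc)) (meanZ _ ck) (meanZ _ cc).
  by rewrite mean_kernel mulr1 mean_chord_kernel.
rewrite -rmorphM -rmorphD ReC; move: Hn; set x := C * _ => Hn; lra.
Qed.

End Fejer.

(** * Uniqueness for the Riemann-Hilbert problem *)

Section Positivity.
Variable R : realType.
Implicit Types (u v : R -> Cx R) (s t : R) (j k m : int).
Local Notation twopi := (pi *+ 2 : R).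
Local Notation em := (@em R).

Lemma diag_weight_ge0 n m : 0 <= diag_weight R n m.
Proof.
by rewrite mulr_ge0 ?invr_ge0// sumr_ge0// => j _; rewrite sumr_ge0.
Qed.

Lemma mean_fejerM n u v : continuous v ->
  mean (fun t => fejer n u t * v t) = n%:R^-1 *
  \sum_(j < n) \sum_(l < n) fourier u (j%:Z - l%:Z) * fourier v (- (j%:Z - l%:Z)).
Proof.
move=> cv; pose w m s : Cx R := v s * em (- - m) s.
have cw m : continuous (w m) by apply: (ccontM cv); exact: em_continuous.
have cwZ (j l : 'I_n) := @ccontZ R (fourier u (j%:Z - l%:Z)) _ (cw (j%:Z - l%:Z)).
have cwS (j : 'I_n) : continuous (fun s =>
    \sum_(l < n) fourier u (j%:Z - l%:Z) * w (j%:Z - l%:Z) s : Cx R).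
  by apply: ccont_sum => l _; exact: cwZ.
have cwSS : continuous (fun s =>
    \sum_(j < n) \sum_(l < n) fourier u (j%:Z - l%:Z) * w (j%:Z - l%:Z) s : Cx R).
  by apply: ccont_sum => i _; exact: cwS.
rewrite (eq_mean (v := fun s => n%:R^-1 *
    (\sum_(j < n) \sum_(l < n) fourier u (j%:Z - l%:Z) * w (j%:Z - l%:Z) s))).
  rewrite (meanZ _ cwSS) (mean_sum _ cwS).
  congr (_ * _); apply: eq_bigr => j _; rewrite (mean_sum _ (cwZ j)).
  by apply: eq_bigr => l _; rewrite (meanZ _ (cw _)).
move=> s _; rewrite /fejer -mulrA; congr (_ * _).
rewrite mulr_suml; apply: eq_bigr => j _; rewrite mulr_suml.
by apply: eq_bigr => l _; rewrite /w opprK; ring.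
Qed.

Lemma fejer_continuous n u : continuous (fejer n u).
Proof.
apply: ccontZ; apply: ccont_sum => j _; apply: ccont_sum => l _.
apply: ccontM; [exact: em_continuous|exact: cst_continuous].
Qed.

Lemma chord_modulus_bounded u : chord_modulus u ->
  exists2 B : R, 0 < B & forall t, 0 <= t <= twopi -> cnorm (u t) <= B.
Proof.
move=> mu; have [C C0 HC] := mu 1 ltr01.
exists (cnorm (u 0) + (1 + C * 2 ^+ 2)).
  by rewrite ltr_wpDl ?cnorm_ge0// ltr_pwDl// mulr_ge0// sqr_ge0.
move=> t tI; rewrite -[u t](subrKC (u 0)).
apply: (le_trans (le_normcD _ _)); rewrite lerD2l.
have I0 : 0 <= (0 : R) <= twopi by rewrite lexx/= mulrn_wge0// pi_ge0.
apply: (le_trans (HC _ _ tI I0)); rewrite lerD2l ler_wpM2l// lerXn2r ?nnegrE ?cnorm_ge0//.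
by apply: (le_trans (le_normcD _ _)); rewrite normcN !cnorm_expi.
Qed.

(** The mean of [u^2 e^(-2imt)] is the sum of the products of the coefficients
    of indices [j] and [2m - j].  One of the two indices is below [m] unless
    [j = m], so that only the square of the [m]-th coefficient remains.  To avoid
    a question of convergence, one of the two factors [u] is first replaced by
    its Fejer sums, which multiplies that square by a weight in [[0, 1]]. *)
Lemma mean_sqr_le0 u m : continuous u -> chord_modulus u ->
  (forall j, j < m -> fourier u j = 0) -> Re (fourier u m ^+ 2) <= 0 ->
  Re (mean (fun t => u t ^+ 2 * em (- (m + m)) t)) <= 0.
Proof.
move=> cu mu um um0; pose w t : Cx R := u t * em (- (m + m)) t.
have cw : continuous w by apply: (ccontM cu); exact: em_continuous.
have fcw j : fourier w j = fourier u (j + (m + m)).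
  apply: eq_mean => t _; rewrite /w -mulrA -emD; congr (_ * em _ _); lia.
have fw n : mean (fun t => fejer n u t * w t) = (diag_weight R n m)%:C * fourier u m ^+ 2.
  rewrite (mean_fejerM n u cw) /diag_weight rmorphM /= fmorphV rmorph_nat -mulrA.
  congr (_ * _); rewrite rmorph_sum mulr_suml; apply: eq_bigr => j _.
  rewrite rmorph_sum mulr_suml; apply: eq_bigr => l _.
  rewrite fcw rmorph_nat; move: (j%:Z - l%:Z) => a.
  have [am|ma|->] := ltgtP a m.
  - by rewrite um// !mul0r.
  - by rewrite [X in _ * X]um ?mulr0 ?mul0r//; lia.
  - by rewrite addKr mul1r.
have [B B0 HB] := chord_modulus_bounded mu.
apply/ler_addgt0Pr => e e0; rewrite add0r.
have [n Hn] := fejer_approx cu mu (divr_gt0 e0 (mulr_gt0 (ltr0n R 2) B0)).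
have cf := @fejer_continuous n.+1 u.
have -> : mean (fun t => u t ^+ 2 * em (- (m + m)) t) =
    mean (fun t => fejer n.+1 u t * w t) - mean (fun t => (fejer n.+1 u t - u t) * w t).
  rewrite -(meanB (ccontM cf cw) (ccontM (ccontB cf cu) cw)).
  by apply: eq_mean => t _; rewrite /w; ring.
rewrite fw ReB ReM ReC ImC mul0r subr0.
have H1 : diag_weight R n.+1 m * Re (fourier u m ^+ 2) <= 0.
  by rewrite mulr_ge0_le0// diag_weight_ge0.
have H2 : cnorm (mean (fun t => (fejer n.+1 u t - u t) * w t)) <= e.
  have cB := @cst_continuous R (Cx R) ((e / (2 * B) * B)%:C).
  apply: (le_trans (mean_le (ccontM (ccontB cf cu) cw) cB _)).
    move=> t tI; rewrite normcM ler_pM ?cnorm_ge0// ?Hn//.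
    by rewrite /w normcM cnorm_em mulr1 HB.
  rewrite mean_cst ReC; have : B != 0 by rewrite gt_eqF.
  by move=> ?; rewrite le_eqVlt; apply/orP; left; apply/eqP; field.
have := cnorm_Re (mean (fun t => (fejer n.+1 u t - u t) * w t)).
by rewrite ler_norml => /andP[H3 _]; lra.
Qed.

Lemma fourier_conj (x : R -> R) j : continuous x ->
  fourier (fun t => (x t)%:C) (- j) = (fourier (fun t => (x t)%:C) j)^*.
Proof.
move=> cx; rewrite /fourier -mean_conj; last first.
  apply: ccontM; last exact: em_continuous.
  by move=> t; apply: continuous_Complex; [exact: cx|exact: cst_continuous].
apply: eq_mean => t _; rewrite rmorphM /= em_conj; congr (_ * _).
by apply: complex_eq => //=; rewrite oppr0.
Qed.

Lemma Re_conjM (z w : R[i]) : Re (conjc z * conjc w) = Re (z * w).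
Proof. by case: z => a b; case: w => c d /=; rewrite mulrNN. Qed.

(** For real [x] the terms of opposite indices in a Fejer sum are conjugate, so
    replacing each negative index by its absolute value changes only the
    imaginary part of the sum, and turns it into a polynomial in [e^(it)]. *)
Lemma poly_approx (x : R -> R) (e : R) : continuous x -> x 0 = x twopi -> 0 < e ->
  exists2 P : Cx R -> Cx R, forall z, cdiff P z &
  forall t, 0 <= t <= twopi -> `|Re (P (expi t)) - x t| <= e.
Proof.
move=> cx x02 e0; pose u t : Cx R := (x t)%:C.
have cu : continuous u.
  by move=> t; apply: continuous_Complex; [exact: cx|exact: cst_continuous].
have u02 : u 0 = u twopi by rewrite /u x02.
have [n Hn] := fejer_approx cu (continuous_chord_modulus cu u02) e0.
pose d (j l : 'I_n.+1) := `|j%:Z - l%:Z|%N.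
exists (fun z => n.+1%:R^-1 * \sum_(j < n.+1) \sum_(l < n.+1) z ^+ d j l * fourier u (d j l)).
  move=> z; apply: cdiffM; first exact: cdiff_cst.
  apply: cdiff_sum => j; apply: cdiff_sum => l; apply: cdiffM; last exact: cdiff_cst.
  by apply: cdiff_exp; exact: cdiff_id.
move=> t /Hn; apply: le_trans; rewrite -[x t]/(Re (u t)).
have -> : Re (n.+1%:R^-1 * (\sum_(j < n.+1) \sum_(l < n.+1) expi t ^+ d j l * fourier u (d j l))) =
    Re (fejer n.+1 u t); last by rewrite -ReB cnorm_Re.
have -> : n.+1%:R^-1 = (n.+1%:R^-1)%:C :> R[i] by rewrite fmorphV rmorph_nat.
rewrite /fejer -[(_ : Cx R)^-1]/((n.+1%:R : R[i])^-1).
have -> : n.+1%:R^-1 = (n.+1%:R^-1)%:C :> R[i] by rewrite fmorphV rmorph_nat.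
rewrite !ReM !ReC !ImC !mul0r !subr0; congr (_ * _).
rewrite !Re_sum; apply: eq_bigr => j _; rewrite !Re_sum; apply: eq_bigr => l _.
rewrite -em_nat /d; have [jl|lj] := leP 0 (j%:Z - l%:Z); first by rewrite gez0_abs.
rewrite ltz0_abs// em_conj fourier_conj//.
exact: Re_conjM.
Qed.

(** [E = e^(iP)], where the real part of the polynomial [P] is within [1/8] of
    the periodic function [tau t = theta t - k t].  The square is then
    [e^(-2 Im P) e^(2i (Re P - tau))], whose argument is at most [1/4] in absolute
    value, less than [pi / 2]. *)
Lemma arg_corrector (theta : R -> R) k : continuous theta ->
  theta twopi - theta 0 = k%:~R * twopi ->
  exists2 E : Cx R -> Cx R, forall z, cdiff E z &
  forall t, 0 <= t <= twopi ->
    0 < Re ((expi (- theta t) * E (expi t) * em k t) ^+ 2).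
Proof.
move=> cth thk; pose tau t := theta t - k%:~R * t.
have ctau : continuous tau.
  move=> t; apply: (@continuousB R R R theta (fun t => k%:~R * t)); first exact: cth.
  by apply: cvgMr; exact: cvg_id.
have tau02 : tau 0 = tau twopi by rewrite /tau mulr0 subr0 -thk; ring.
have e0 : 0 < 1 / 8 :> R by rewrite divr_gt0.
have [P dP HP] := poly_approx ctau tau02 e0.
exists (fun z => cexp (iC * P z)).
  move=> z; apply: (@cdiff_comp R (fun z => iC * P z) (@cexp R)); last exact: cdiff_cexp.
  by apply: cdiffM; [exact: cdiff_cst|exact: dP].
move=> t tI; set p := P (expi t).
have -> : expi (- theta t) * cexp (iC * p) * em k t =
    (expR (- Im p))%:C * expi (Re p - tau t).
  rewrite /cexp /em !ReImE mul0r mul1r sub0r mul0r mul1r add0r.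
  rewrite -mulrA mulrCA -!mulrA; congr (_ * _).
  by rewrite -!expiD; congr expi; rewrite /tau; ring.
rewrite exprMn -rmorphXn ReM ReC ImC mul0r subr0 mulr_gt0 ?exprn_gt0 ?expR_gt0//.
rewrite expr2 -expiD [Re _]/=.
have := HP t tI; rewrite -/p ler_norml => /andP[h1 h2].
have := pi_ge2 R => pi2.
by apply: cos_gt0_pihalf; apply/andP; split; lra.
Qed.

(** With [r] the real function [F e^(i theta)] on the circle, [h^2 e^(2ikt)] is
    [r^2] times the square with positive real part.  The mean of its real part
    is nonpositive by [mean_sqr_le0], so [r] vanishes. *)
Lemma riemann_hilbert_uniq (theta : R -> R) k (E : Cx R -> Cx R) (F : Cx R -> Cx R) :
  (forall z, cdiff E z) ->
  (forall t, 0 <= t <= twopi ->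
    0 < Re ((expi (- theta t) * E (expi t) * em k t) ^+ 2)) ->
  holo F -> (forall t, 0 <= t <= twopi -> Im (F (expi t) * expi (theta t)) = 0) ->
  let h t := F (expi t) * E (expi t) in
  (forall j, 0 <= j < - k -> fourier h j = 0) -> (0 <= - k -> Re (fourier h (- k)) = 0) ->
  forall t, 0 <= t <= twopi -> F (expi t) = 0.
Proof.
move=> dE Epos hF Fbd h hj hk.
have hFE : holo (fun z => F z * E z) := holoM hF (cdiff_holo dE).
have ch : continuous h := holo_expi hFE.
have mh : chord_modulus h.
  by apply: continuous_chord_modulus => //; rewrite /h expi_2pi expi0.
have fneg j : j < 0 -> fourier h j = 0 by move=> j0; exact: (holo_fourier hFE).
have fz j : j < - k -> fourier h j = 0.
  by move=> jk; have [j0|j0] := ltP j 0; [exact: fneg|rewrite hj// j0].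
have fk : Re (fourier h (- k) ^+ 2) <= 0.
  have sq : Re (fourier h (- k)) = 0 -> Re (fourier h (- k) ^+ 2) <= 0.
    by move=> r0; rewrite expr2 ReM r0 mul0r sub0r oppr_le0 -expr2 sqr_ge0.
  have [k0|k0] := leP 0 (- k); first exact: sq (hk k0).
  by apply: sq; rewrite fneg.
have := mean_sqr_le0 ch mh fz fk.
set g := fun t => _ => mg.
have cg : continuous g.
  by apply: ccontM; [under eq_fun do rewrite expr2; exact: ccontM|exact: em_continuous].
pose r t := Re (F (expi t) * expi (theta t)).
pose A t := Re ((expi (- theta t) * E (expi t) * em k t) ^+ 2).
have Reg t : 0 <= t <= twopi -> Re (g t) = r t ^+ 2 * A t.
  move=> tI; have FE : F (expi t) = (r t)%:C * expi (- theta t).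
    have -> : (r t)%:C = F (expi t) * expi (theta t).
      by apply: complex_eq => //; rewrite Fbd.
    by rewrite -mulrA -expiD subrr expi0 mulr1.
  have -> : g t = (r t ^+ 2)%:C * (expi (- theta t) * E (expi t) * em k t) ^+ 2.
    rewrite /g /h FE -opprD opprK emD rmorphXn; ring.
  by rewrite ReM ReC ImC mul0r subr0.
move=> t tI; have : Re (g t) = 0.
  apply: (Re_mean_le0 cg) => // s sI.
  by rewrite Reg// mulr_ge0 ?sqr_ge0// ltW// Epos.
rewrite Reg// => /eqP; rewrite mulf_eq0 expf_eq0 /= => /orP[/eqP rt|]; last first.
  by rewrite gt_eqF// Epos.
have : F (expi t) * expi (theta t) = 0.
  by apply: complex_eq; [exact: rt|rewrite Fbd].
move=> /(congr1 (fun z => z * expi (- theta t))).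
by rewrite mul0r -mulrA -expiD subrr expi0 mulr1.
Qed.

End Positivity.

(** * Dimension bounds from linear dependence *)

Section FiniteDimension.
Variables (R : realType) (n : nat).
Implicit Types (X : set (Cx R)) (V : set (Cx R -> Cn R n)).

(** An independent family in [V] whose length [d] is the least without an
    independent family of length [d + 1] is a basis: adjoining any element of [V]
    makes it dependent, with a nonzero coefficient on that element. *)
Lemma has_real_dim_of_dependent X V (N : nat) :
  (forall e : 'I_N.+1 -> Cx R -> Cn R n, (forall i, V (e i)) ->
    exists2 c : 'I_N.+1 -> R, (exists i, c i != 0) &
      forall s, X s -> \sum_i (c i)%:C *: e i s = 0) ->
  exists2 d : nat, (d <= N)%N & has_real_dim_on X V d.
Proof.
move=> depN.
pose indep d := exists e : 'I_d -> Cx R -> Cn R n, (forall i, V (e i)) /\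
  forall c : 'I_d -> R, (forall s, X s -> \sum_i (c i)%:C *: e i s = 0) ->
  forall i, c i = 0.
have exN : exists d, `[< ~ indep d.+1 >].
  exists N; apply/asboolP => -[e [Ve ie]].
  have [c [i ci] Hc] := depN e Ve.
  by move: ci; rewrite (ie c Hc i) eqxx.
case: (ex_minnP exN) => d /asboolP dNS dmin.
have [e [Ve ie]] : indep d.
  case: d dNS dmin => [|d] dNS dmin.
    by exists (fun=> fun=> 0); split=> [[]|c _ []].
  by apply: contrapT => /asboolP /dmin; rewrite ltnn.
exists d.
  apply: dmin; apply/asboolP => -[e' [Ve' ie']].
  have [c [i ci] Hc] := depN e' Ve'.
  by move: ci; rewrite (ie' c Hc i) eqxx.
exists e; split => // a Va.
pose e' (i : 'I_d.+1) := if insub (i : nat) is Some j then e j else a.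
have e'w (j : 'I_d) : e' (widen_ord (leqnSn d) j) = e j.
  by rewrite /e' /= valK.
have e'm : e' ord_max = a by rewrite /e' insubN//= ltnn.
have Ve' i : V (e' i) by rewrite /e'; case: insubP.
have [c [Hc /existsNP[i0 ci0]]] : exists c : 'I_d.+1 -> R,
    (forall s, X s -> \sum_i (c i)%:C *: e' i s = 0) /\ ~ forall i, c i = 0.
  apply: contrapT => H; apply: dNS; exists e'; split => // c Hc.
  by apply: contrapT => nc; apply: H; exists c.
have Hc' s : X s ->
    \sum_(i < d) (c (widen_ord (leqnSn d) i))%:C *: e i s + (c ord_max)%:C *: a s = 0.
  move=> /Hc; rewrite big_ord_recr /= e'm => H; rewrite -[RHS]H; congr (_ + _).
  by apply: eq_bigr => j _; rewrite e'w.
have cm : c ord_max != 0.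
  apply/eqP => cm; apply: ci0.
  have c0 : forall j : 'I_d, c (widen_ord (leqnSn d) j) = 0.
    by apply: ie => s /Hc'; rewrite cm scale0r addr0.
  have [->//|im] := eqVneq i0 ord_max.
  have id : (i0 < d)%N by rewrite ltn_neqAle -ltnS ltn_ord andbT (inj_eq val_inj _ ord_max).
  by rewrite -(c0 (Ordinal id)); congr c; exact: val_inj.
exists (fun i => - (c (widen_ord (leqnSn d) i) / c ord_max)) => s /Hc' /eqP.
rewrite addrC addr_eq0 => /eqP H.
have cmC : (c ord_max)%:C != 0 by rewrite fmorph_eq0.
apply: (scalerI cmC); rewrite H -sumrN scaler_sumr; apply: eq_bigr => i _.
rewrite scalerA -scaleNr; congr (_ *: _).
by rewrite -rmorphM -rmorphN mulrN mulrC divfK.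
Qed.

End FiniteDimension.

(** * The real dimension of the solution space *)

Section RealForms.
Variables (R : realType).
Local Notation twopi := (pi *+ 2 : R).

Lemma holoD (F G : Cx R -> Cx R) : holo F -> holo G -> holo (fun z => F z + G z).
Proof.
move=> [cF dF] [cG dG]; split.
  by move=> z; apply: continuousD; [exact: cF|exact: cG].
by move=> z Dz; apply: cdiffD; [exact: dF|exact: dG].
Qed.

Lemma holo_sum (J : Type) (r : seq J) (c : J -> R[i]) (F : J -> Cx R -> Cx R) :
  (forall j, holo (F j)) -> holo (fun z => \sum_(j <- r) c j * F j z).
Proof.
move=> hF; elim: r => [|j r hG].
  under eq_fun do rewrite big_nil.
  by apply: cdiff_holo => z; exact: cdiff_cst.
have hc : holo (fun=> c j : Cx R) by apply: cdiff_holo => z; exact: cdiff_cst.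
by under eq_fun do rewrite big_cons; apply: holoD hG; exact: holoM (hF j).
Qed.

Lemma fourier_sum (I : finType) (c : I -> R[i]) (h : I -> R -> Cx R) (j : int) :
  (forall i, continuous (h i)) ->
  fourier (fun t => \sum_i c i * h i t) j = \sum_i c i * fourier (h i) j.
Proof.
move=> ch; pose w i t : Cx R := h i t * em (- j) t.
have cw i : continuous (w i) by apply: (ccontM (ch i)); exact: em_continuous.
have cZ i := @ccontZ R (c i) _ (cw i).
rewrite /fourier (eq_mean (v := fun t => \sum_i c i * w i t)).
  rewrite (mean_sum _ cZ); apply: eq_bigr => i _.
  by rewrite (meanZ _ (cw i)).
by move=> t _; rewrite mulr_suml; apply: eq_bigr => i _; rewrite /w mulrA.
Qed.

(** If [k <= 0], the conditions of [riemann_hilbert_uniq] are [1 - 2k <= N] real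
    linear equations in the [N + 1] coefficients of a combination of the [G i];
    if [k > 0] there is no condition. *)
Lemma dependent_riemann_hilbert (theta : R -> R) (k : int) (N : nat)
    (G : 'I_N.+1 -> Cx R -> Cx R) :
  continuous theta -> theta twopi - theta 0 = k%:~R * twopi ->
  (- 2%:Z * k + 1 <= N%:Z) ->
  (forall i, holo (G i)) ->
  (forall i t, 0 <= t <= twopi -> Im (G i (expi t) * expi (theta t)) = 0) ->
  exists2 c : 'I_N.+1 -> R, (exists i, c i != 0) &
    forall t, 0 <= t <= twopi -> \sum_i (c i)%:C * G i (expi t) = 0.
Proof.
move=> cth thk kN hG Gbd; have [E dE Epos] := arg_corrector cth thk.
pose h i t : Cx R := G i (expi t) * E (expi t).
have ch i : continuous (h i) := holo_expi (holoM (hG i) (cdiff_holo dE)).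
(* Column 2p holds the real part and column 2p + 1 the imaginary part of the
   p-th Fourier coefficient. *)
pose A := \matrix_(i < N.+1, q < N)
  (if odd q then Im (fourier (h i) q./2) else Re (fourier (h i) q./2)).
have : kermx A != 0.
  rewrite kermx_eq0 /row_free; apply/eqP => rA.
  by have := rank_leq_col A; rewrite rA ltnn.
move/rowV0Pn => [v /sub_kermxP vA v0].
have [i0 vi0] : exists i, v 0 i != 0.
  apply: contrapT => H; move/eqP: v0; apply; apply/rowP => i; rewrite mxE.
  by apply/eqP; apply: contrapT => vi; apply: H; exists i; exact/negP.
exists (v 0); first by exists i0.
pose F z : Cx R := \sum_i (v 0 i)%:C * G i z.
have hF : holo F by exact: holo_sum.
have Fbd t : 0 <= t <= twopi -> Im (F (expi t) * expi (theta t)) = 0.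
  move=> tI; rewrite mulr_suml Im_sum big1// => i _.
  by rewrite -mulrA ImM ReC ImC mul0r Gbd// mulr0 addr0.
have fcF (j : int) : fourier (fun t => F (expi t) * E (expi t)) j =
    \sum_i (v 0 i)%:C * fourier (h i) j.
  rewrite -(fourier_sum _ _ ch); apply: eq_mean => t _; congr (_ * _).
  by rewrite /F mulr_suml; apply: eq_bigr => i _; rewrite mulrA.
have vAq (q : 'I_N) : \sum_i v 0 i * (if odd q then Im (fourier (h i) q./2)
    else Re (fourier (h i) q./2)) = 0.
  have := congr1 (fun B : 'rV_N => B 0 q) vA; rewrite !mxE => H; rewrite -[RHS]H.
  by apply: eq_bigr => i _; rewrite mxE.
have ReF (p : nat) : (p.*2 < N)%N -> Re (fourier (fun t => F (expi t) * E (expi t)) p) = 0.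
  move=> pN; have := vAq (Ordinal pN); rewrite /= odd_double doubleK => H.
  rewrite fcF Re_sum -[RHS]H; apply: eq_bigr => i _.
  by rewrite ReM ReC ImC mul0r subr0.
have ImF (p : nat) : (p.*2.+1 < N)%N -> Im (fourier (fun t => F (expi t) * E (expi t)) p) = 0.
  move=> pN; have := vAq (Ordinal pN); rewrite /= odd_double uphalf_double => H.
  rewrite fcF Im_sum -[RHS]H; apply: eq_bigr => i _.
  by rewrite ImM ReC ImC mul0r addr0.
apply: (riemann_hilbert_uniq dE Epos hF Fbd).
  case=> // p /andP[_ pk]; apply: complex_eq; first by apply: ReF; lia.
  by apply: ImF; lia.
move=> k0; have -> : - k = `|k|%N :> int by lia.
by apply: ReF; lia.
Qed.

Lemma unit_circleP (s : Cx R) : unit_circle s -> exists2 t : R, 0 <= t <= twopi & s = expi t.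
Proof.
case: s => a b; rewrite /unit_circle /= normE => /(congr1 (@complex.Re R)) /= s1.
have ab : a ^+ 2 + b ^+ 2 = 1.
  by have := sqr_cnorm (a +i* b); rewrite s1 expr1n /= => <-.
have a1 : -1 <= a <= 1.
  by rewrite -ler_norml -(@ler_sqr R) ?nnegrE// real_normK ?num_real// expr1n -ab lerDl sqr_ge0.
have sa : Num.sqrt (1 - a ^+ 2) = `|b| by rewrite -ab addrAC subrr add0r sqrtr_sqr.
have ca : cos (acos a) = a by apply: acosK; rewrite in_itv.
have sca : sin (acos a) = `|b| by rewrite sin_acos.
have [t0 tpi] : 0 <= acos a /\ acos a <= pi by split; [exact: acos_ge0|exact: acos_lepi].
have pi0 := pi_ge0 R.
have [b0|b0] := leP 0 b.
  exists (acos a); first by rewrite t0 /= (le_trans tpi)// mulr2n lerDl.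
  by rewrite /expi ca sca ger0_norm.
exists (twopi - acos a).
  by rewrite lerBlDr lerDl t0 andbT subr_ge0 (le_trans tpi)// mulr2n lerDl.
rewrite /expi cosB sinB cos2pi sin2pi ca sca ltr0_norm//.
by rewrite !mul1r !mul0r addr0 sub0r opprK.
Qed.

End RealForms.

(** * Conormal forms along the boundary of the disc *)

Section Conormal.
Variables (R : realType) (n : nat).
Implicit Types (a v w : Cn R n).

Lemma form_evalDr a v w : form_eval a (v + w) = form_eval a v + form_eval a w.
Proof. by rewrite -big_split; apply: eq_bigr => j _; rewrite mxE mulrDr. Qed.

Lemma form_evalZr a v (z : R[i]) : form_eval a (z *: v) = z * form_eval a v.
Proof. by rewrite mulr_sumr; apply: eq_bigr => j _; rewrite mxE mulrCA. Qed.

Lemma form_eval_suml (I : finType) (c : I -> R[i]) (a : I -> Cn R n) v :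
  form_eval (\sum_i c i *: a i) v = \sum_i c i * form_eval (a i) v.
Proof.
rewrite /form_eval (eq_bigr (fun j => \sum_i c i * (a i 0 j * v 0 j))).
  by rewrite exchange_big; apply: eq_bigr => i _; rewrite mulr_sumr.
move=> j _; rewrite summxE mulr_suml; apply: eq_bigr => i _.
by rewrite mxE mulrA.
Qed.

Lemma toR2D v w : toR2 (v + w) = toR2 v + toR2 w.
Proof. by congr (_, _); apply/matrixP => i j; rewrite !mxE ?ReD ?ImD. Qed.

Lemma toR2Z (x : R) v : toR2 (x%:C *: v) = x *: toR2 v.
Proof.
congr (_, _); apply/matrixP => i j; rewrite !mxE !ReImE mul0r ?subr0 ?addr0//.
Qed.

Lemma differentialD (rho : Cn R n -> R) p v w :
  differential rho p (v + w) = differential rho p v + differential rho p w.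
Proof. by rewrite /differential toR2D linearD. Qed.

Lemma differentialZ (rho : Cn R n -> R) p (x : R) v :
  differential rho p (x%:C *: v) = x * differential rho p v.
Proof. by rewrite /differential toR2Z linearZ. Qed.

(** The complex line of [v] is not contained in the real hyperplane [ker d rho],
    since otherwise both [v] and [-i v] would be tangent and [v] would be a
    nonzero complex tangent vector.  So the line and the hyperplane span the whole
    space over the reals, and the imaginary part of [a] vanishes on both. *)
Lemma conormal_determined (eps : R) (M : set (Cn R n)) (p a v : Cn R n) :
  hypersurface eps M -> M p -> conormal_fiber eps M p a ->
  complex_tangent_space eps M p `&` [set` <[v]>%VS] = [set 0] -> v != 0 ->
  form_eval a v = 0 -> a = 0.
Proof.
move=> hM Mp ca Tv v0 av.
have [U [rho hrho]] := hM p Mp.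
pose D w := differential rho p w.
have kerT w : D w = 0 -> tangent_space eps M p w by move=> Dw; exists U, rho.
have [w Dw aw] : exists2 w, D w != 0 & form_eval a w = 0.
  have [Dv|] := eqVneq (D v) 0; last by exists v.
  have [Div|] := eqVneq (D (iC *: v)) 0; last first.
    by exists (iC *: v) => //; rewrite form_evalZr av mulr0.
  have : (complex_tangent_space eps M p `&` [set` <[v]>%VS]) v.
    split; last exact: memv_line.
    split; first exact: kerT.
    exists ((-1)%:C *: (iC *: v)).
      by apply: kerT; rewrite /D differentialZ [X in _ * X]Div mulr0.
    rewrite !scalerA -[RHS]scale1r; congr (_ *: _).
    by apply: complex_eq; rewrite !ReImE; ring.
  by rewrite Tv => /eqP; rewrite (negbTE v0).
have Ima u : Im (form_eval a u) = 0.
  pose x := D u / D w.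
  have : D (u + (- x)%:C *: w) = 0.
    by rewrite /D differentialD differentialZ mulNr divfK// subrr.
  by move=> /kerT/ca; rewrite form_evalDr form_evalZr aw mulr0 addr0.
have a0 u : form_eval a u = 0.
  apply: complex_eq; last exact: Ima.
  have := Ima (iC *: u); rewrite form_evalZr ImM Re_iC Im_iC mul0r mul1r add0r.
  by [].
apply/rowP => j; rewrite mxE -[RHS](a0 (delta_mx 0 j)) /form_eval.
rewrite (bigD1 j)//= mxE !eqxx mulr1 big1 ?addr0// => i ij.
by rewrite mxE (negbTE ij) andbF mulr0.
Qed.

Lemma conormal_lin (eps : R) (M : set (Cn R n)) (p : Cn R n) (I : finType)
    (c : I -> R) (a : I -> Cn R n) :
  (forall i, conormal_fiber eps M p (a i)) ->
  conormal_fiber eps M p (\sum_i (c i)%:C *: a i).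
Proof.
move=> ca v Tv; rewrite form_eval_suml.
by rewrite Im_sum big1// => i _; rewrite ImM ReC ImC mul0r addr0 ca// mulr0.
Qed.

End Conormal.

(** * The bound on the defect *)

Theorem proposition2 (R : realType) (n : nat) (eps delta : R)
    (M : set (Cn R n)) (phi : Cx R -> Cn R n) (L : {vspace Cn R n}) (k : int)
    (heps : 0 < eps < 1)
    (hdelta : 0 < delta < eps)
    (hM : hypersurface eps M)
    (hM' : exists M' : set (Cn R n),
       hypersurface eps M' /\ relatively_compact_open_part M M')
    (hphi : analytic_disc delta phi)
    (hphiM : forall s : Cx R, unit_circle s -> M (phi s))
    (hL : \dim L = 1%N)
    (hTcL : forall s : Cx R, unit_circle s ->
       complex_tangent_space eps M (phi s) `&` [set` L] = [set 0])
    (hk : number_of_turns L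
       (fun s : Cx R => tangent_space eps M (phi s) `&` [set` L]) k) :
  exists d : nat,
    has_defect eps delta M phi d /\ (d%:Z <= Num.max 0 (- 2%:Z * k + 1))%R.
Proof.
have [v [theta [[v0 vL] cth lth thk]]] := hk.
pose twopi : R := pi *+ 2; have twopi_ge0 : 0 <= twopi by rewrite mulrn_wge0// pi_ge0.
(* theta is only given on [0, 2 pi]; it is extended by constants to R. *)
pose clamp (t : R) : R := Num.max 0 (Num.min twopi t).
have clampI t : `[0, twopi]%classic (clamp t).
  by rewrite /= in_itv /= le_max lexx/= ge_max twopi_ge0 ge_min lexx.
have clampK t : 0 <= t <= twopi -> clamp t = t.
  by move=> /andP[t0 tP]; rewrite /clamp min_r// max_r.
have cclamp : continuous clamp.
  move=> t; apply: (@continuous_max R R (cst 0) (fun t => Num.min twopi t)).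
    exact: cst_continuous.
  by apply: (@continuous_min R R (cst twopi) id); [exact: cst_continuous|exact: cvg_id].
pose th t := theta (clamp t).
have cth' : continuous th.
  by move=> t; exact: (within_continuous_comp cth clampI (cclamp t)).
have thk' : th twopi - th 0 = k%:~R * twopi by rewrite /th !clampK ?lexx ?twopi_ge0.
pose N : nat := absz (Num.max 0 (- 2%:Z * k + 1)).
have NE : N%:Z = Num.max 0 (- 2%:Z * k + 1) by rewrite gez0_abs// le_max lexx.
suff [d dN hd] : exists2 d : nat, (d <= N)%N & has_defect eps delta M phi d.
  by exists d; split => //; rewrite -NE lez_nat.
apply: has_real_dim_of_dependent => a Va.
have extG (i : 'I_N.+1) : exists G : Cx R -> Cx R, holo G /\
    forall s, unit_circle s -> G s = form_eval (a i s) v.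
  have [_ _ /choice[F HF]] := Va i.
  exists (fun z => \sum_j v 0 j * F j z); split.
    apply: holo_sum => j; have [cF dF _] := HF j; split => // z /dF.
    exact: derivable_cdiff.
  move=> s s1; apply: eq_bigr => j _; have [_ _ ->//] := HF j.
  by rewrite mulrC.
have [G HG] := choice extG.
have kN : - 2%:Z * k + 1 <= N%:Z by rewrite NE le_max lexx orbT.
have Gbd i t : 0 <= t <= twopi -> Im (G i (expi t) * expi (th t)) = 0.
  move=> tI; have st := @unit_circle_expi R t.
  have [_ GE] := HG i; rewrite GE// mulrC -form_evalZr.
  have [ca _ _] := Va i; apply: (ca _ st).
  suff [] : (tangent_space eps M (phi (expi t)) `&` [set` L]) (expi (th t) *: v) by [].
  by rewrite lth//; exists 1 => //; rewrite mul1r /th clampK.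
have [c cn0 cG] := dependent_riemann_hilbert cth' thk' kN (fun i => (HG i).1) Gbd.
exists c => // s s1.
have [t tI st] := unit_circleP s1.
apply: (conormal_determined hM (hphiM s s1) _ _ v0).
- by apply: conormal_lin => i; have [ca _ _] := Va i; exact: ca.
- by rewrite vL; exact: hTcL.
- rewrite form_eval_suml -[RHS](cG t tI); apply: eq_bigr => i _.
  by have [_ ->] := HG i; rewrite -st.
Qed.
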